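(* Let $R$ be a left noetherian associative unital ring and $M$ an $R$-complex such that $H_i(M)$ is a finitely generated $R$-module for every $i\in\mathbb{Z}$ and $H_i(M)=0$ for $i\ll 0$. There is a semi-projective resolution $L\xrightarrow{\simeq} M$ with $L$ pure-minimal and degreewise finitely generated. Furthermore, for every such resolution $L\xrightarrow{\simeq} M$ (that is, every semi-projective resolution with $L$ pure-minimal and degreewise finitely generated) one has $$\operatorname{proj.dim}_R M=\sup\{\, i\mid L_i\neq 0\,\}.$$
   Context: $R$-modules are left modules. An $R$-complex is a (possibly unbounded) chain complex $M$ of $R$-modules, indexed homologically; $Z_i(M)=\operatorname{Ker}(\partial_i^M)$; $\mathcal{C}(R)$ is the category of $R$-complexes and chain maps, with hom-sets $\operatorname{hom}_{\mathcal{C}(R)}(L,M)$. A complex $L$ is degreewise finitely generated if every module $L_i$ is finitely generated. An $R$-complex $P$ is semi-projective if every $P_i$ is projective and the total Hom functor $\operatorname{Hom}_R(P,-)$ preserves acyclicity of $R$-complexes. A semi-projective resolution of $M$ is a quasi-isomorphism $P\to M$ with $P$ semi-projective. The projective dimension $\operatorname{proj.dim}_R M\in\mathbb{Z}\cup\{\pm\infty\}$ is the infimum of the integers $n$ such that $M$ is isomorphic in the derived category to a semi-projective $R$-complex $P$ with $P_i=0$ for all $i>n$. Conventions: $\sup\varnothing=-\infty$, $\inf\varnothing=\infty$. An exact sequence of $R$-modules is pure if $\operatorname{Hom}_R(A,-)$ leaves it exact for every finitely presented $R$-module $A$. A subcomplex $L\subseteq M$ is pure if $0\to\operatorname{hom}_{\mathcal{C}(R)}(A,L)\to\operatorname{hom}_{\mathcal{C}(R)}(A,M)\to\operatorname{hom}_{\mathcal{C}(R)}(A,M/L)\to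 0$ is exact for every bounded complex $A$ of finitely presented $R$-modules. An $R$-complex $M$ is pure-acyclic if it is acyclic and $0\to Z_i(M)\to M_i\to Z_{i-1}(M)\to 0$ is a pure exact sequence of $R$-modules for every $i\in\mathbb{Z}$. An $R$-complex is pure-minimal if the zero complex is its only pure-acyclic pure subcomplex. *)

(* Defs.v *)
From HB Require Import structures.
From mathcomp Require Import all_boot all_order all_algebra.
From mathcomp Require Import ring_quotient.
From mathcomp Require Import boolp classical_sets constructive_ereal.

Set Implicit Arguments.
Unset Strict Implicit.
Unset Printing Implicit Defensive.

Import Order.TTheory GRing.Theory Num.Theory.
Local Open Scope ring_scope.
Local Open Scope quotient_scope.

(* Submodules are the library's [submodClosed] predicates.  These are boolean,
   but under the classical axioms of [boolp] every subset is decidable, so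
   every submodule is of this form. *)

Section SubQuotient.
Variables (R : pzRingType) (V : lmodType R) (S : submodClosed V).

Record submod := Submod { submod_val : V; submod_valP : submod_val \in S }.
HB.instance Definition _ := [isSub of submod for submod_val].
HB.instance Definition _ := [Choice of submod by <:].
HB.instance Definition _ := [SubChoice_isSubLmodule of submod by <:].

(* [submodClosed] does not carry closure under opposite, which the library's
   quotient of additive groups asks for. *)
Definition zpred : {pred V} := fun x => x \in S.

Lemma zpred_closed : zmod_closed zpred.
Proof.
split=> [|x y xS yS]; first exact: rpred0.
suff: x - y \in S by [].
by rewrite -scaleN1r rpredD ?rpredZ.
Qed.
HB.instance Definition _ := GRing.isZmodClosed.Build V zpred zpred_closed.

Definition quotmod := Quotient.quot zpred.
HB.instance Definition _ := GRing.Zmodule.on quotmod.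

Definition qproj (x : V) : quotmod := \pi_(Quotient.quot zpred) x.
Definition qrepr (q : quotmod) : V := @repr _ (Quotient.quot zpred) q.

Lemma qreprK : cancel qrepr qproj.
Proof. exact: reprK. Qed.

Lemma qproj_eq x y : (qproj x = qproj y) <-> (x - y \in S).
Proof.
split=> [h|h].
  have : (x - y) \in zpred by rewrite Quotient.idealrBE; apply/eqP.
  by [].
have : (x - y) \in zpred by [].
by rewrite Quotient.idealrBE => /eqP.
Qed.

Lemma qproj_zmod_morphism : zmod_morphism qproj.
Proof. by move=> x y; rewrite /qproj !piE. Qed.
HB.instance Definition _ :=
  GRing.isZmodMorphism.Build V quotmod qproj qproj_zmod_morphism.

Definition qscale (a : R) (q : quotmod) : quotmod := qproj (a *: qrepr q).

Lemma qscaleE a x : qscale a (qproj x) = qproj (a *: x).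
Proof.
apply/qproj_eq; rewrite -scalerBr rpredZ //.
by apply/qproj_eq; rewrite qreprK.
Qed.

Lemma qscaleA a b q : qscale a (qscale b q) = qscale (a * b) q.
Proof. by rewrite -[q]qreprK !qscaleE scalerA. Qed.

Lemma qscale1 : left_id 1 qscale.
Proof. by move=> q; rewrite -[q]qreprK !qscaleE scale1r. Qed.

Lemma qscaleDr : right_distributive qscale +%R.
Proof.
move=> a p q; rewrite -[p]qreprK -[q]qreprK -raddfD !qscaleE.
by rewrite scalerDr raddfD.
Qed.

Lemma qscaleDl q : {morph qscale^~ q : a b / a + b}.
Proof.
by move=> a b; rewrite -[q]qreprK !qscaleE scalerDl raddfD.
Qed.

HB.instance Definition _ := GRing.Zmodule_isLmodule.Build R quotmod
  qscaleA qscale1 qscaleDr qscaleDl.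

Lemma qproj_scalable : scalable qproj.
Proof. by move=> a x; rewrite -qscaleE. Qed.
HB.instance Definition _ :=
  GRing.isScalable.Build R V quotmod *:%R qproj qproj_scalable.

End SubQuotient.

Section InducedMaps.
Variables (R : pzRingType) (V W : lmodType R).
Variables (S : submodClosed V) (T : submodClosed W).
Variable (f : {linear V -> W}).
Hypothesis fST : forall x, x \in S -> f x \in T.

Definition submod_map (x : submod S) : submod T :=
  Submod (fST (submod_valP x)).

Lemma submod_map_linear : linear submod_map.
Proof. by move=> a x y; apply: val_inj; rewrite /= linearP. Qed.
HB.instance Definition _ :=
  GRing.isLinear.Build R (submod S) (submod T) *:%R submod_map
    submod_map_linear.

#[using="fST"]
Definition quotmod_map (q : quotmod S) : quotmod T := qproj T (f (qrepr q)).

Lemma quotmod_mapE x : quotmod_map (qproj S x) = qproj T (f x).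
Proof.
apply/qproj_eq; rewrite -raddfB; apply: fST.
by apply/qproj_eq; rewrite qreprK.
Qed.

Lemma quotmod_map_linear : linear quotmod_map.
Proof.
move=> a p q; rewrite -[p]qreprK -[q]qreprK -linearP !quotmod_mapE.
by rewrite !linearP.
Qed.
HB.instance Definition _ :=
  GRing.isLinear.Build R (quotmod S) (quotmod T) *:%R quotmod_map
    quotmod_map_linear.

End InducedMaps.

Section KernelImage.
Variables (R : pzRingType) (V W : lmodType R) (f : {linear V -> W}).

Definition ker_pred : {pred V} := fun x => f x == 0.
Lemma ker_pred_closed : subsemimod_closed ker_pred.
Proof.
split=> [|a x]; first split=> [|x y].
- by rewrite unfold_in linear0.
- by rewrite !unfold_in linearD => /eqP-> /eqP->; rewrite addr0.
- by rewrite !unfold_in linearZ_LR => /eqP->; rewrite scaler0.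
Qed.
HB.instance Definition _ :=
  GRing.isSubmodClosed.Build R V ker_pred ker_pred_closed.

Definition im_pred : {pred W} := fun y => `[< exists x, f x = y >].
Lemma im_pred_closed : subsemimod_closed im_pred.
Proof.
split=> [|a y]; first split=> [|y z].
- by apply/asboolP; exists 0; rewrite linear0.
- move=> /asboolP[x <-] /asboolP[x' <-]; apply/asboolP.
  by exists (x + x'); rewrite linearD.
- by move=> /asboolP[x <-]; apply/asboolP; exists (a *: x); rewrite linearZ.
Qed.
HB.instance Definition _ :=
  GRing.isSubmodClosed.Build R W im_pred im_pred_closed.

End KernelImage.

Section Modules.
Variable R : pzRingType.

Definition zero_module (V : lmodType R) : Prop := forall x : V, x = 0.

Definition fin_gen (V : lmodType R) : Prop :=
  exists (n : nat) (g : 'I_n -> V),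
    forall x, exists a : 'I_n -> R, x = \sum_(i < n) a i *: g i.

Definition fin_pres (V : lmodType R) : Prop :=
  exists (n : nat) (g : {linear 'rV[R]_n -> V}),
    (forall x, exists v, g v = x) /\ fin_gen (submod (ker_pred g)).

(* The left ideals of R are the submodules of the left module R^o. *)
Definition left_noetherian : Prop :=
  forall I : submodClosed R^o, fin_gen (submod I).

Definition projective (P : lmodType R) : Prop :=
  forall (V W : lmodType R) (g : {linear V -> W}) (f : {linear P -> W}),
    (forall w, exists v, g v = w) ->
    exists h : {linear P -> V}, forall x, g (h x) = f x.

Definition short_exact (U V W : lmodType R)
    (f : {linear U -> V}) (g : {linear V -> W}) : Prop :=
  [/\ injective f,
      forall v, g v = 0 <-> exists u, f u = v &
      forall w, exists v, g v = w].

Definition pure_exact (U V W : lmodType R)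
    (f : {linear U -> V}) (g : {linear V -> W}) : Prop :=
  short_exact f g /\
  forall A : lmodType R, fin_pres A ->
    [/\ forall h h' : {linear A -> U}, f \o h =1 f \o h' -> h =1 h',
        forall k : {linear A -> V},
          g \o k =1 (fun=> 0) <-> exists h : {linear A -> U}, f \o h =1 k &
        forall l : {linear A -> W}, exists k : {linear A -> V}, g \o k =1 l].

End Modules.

Section Complexes.
Variable R : pzRingType.

(* The differential is given by a map from L_i to L_j for all i and j, which
   is zero unless i = j + 1; this avoids transports along index equalities. *)
Record complex := Complex {
  cobj :> int -> lmodType R;
  cdiff : forall i j, {linear cobj i -> cobj j};
  cdiff_shape : forall i j, i != j + 1 -> forall x, cdiff i j x = 0;
  cdiff2 : forall i j k x, cdiff j k (cdiff i j x) = 0 }.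

Record chain_map (L M : complex) := ChainMap {
  cmap :> forall i, {linear L i -> M i};
  cmapC : forall i j x, cdiff M i j (cmap i x) = cmap j (cdiff L i j x) }.

Definition id_chain_map (L : complex) : chain_map L L :=
  @ChainMap L L (fun i => idfun) (fun i j x => erefl).

Definition cycles (M : complex) (i : int) : submodClosed (M i) :=
  ker_pred (cdiff M i (i - 1)).

Lemma cdiff_cycles (M : complex) i j x : cdiff M i j x \in cycles M j.
Proof. by rewrite unfold_in cdiff2. Qed.

(* The corestriction M_i -> Z_j(M) of the differential; the target index is
   free so that it serves both as M_{i+1} -> Z_i and as M_i -> Z_{i-1}. *)
Definition cdiffZ (M : complex) i j (x : M i) : submod (cycles M j) :=
  Submod (cdiff_cycles j x).

Lemma cdiffZ_linear (M : complex) i j : linear (@cdiffZ M i j).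
Proof. by move=> a x y; apply: val_inj; rewrite /= linearP. Qed.
HB.instance Definition _ (M : complex) i j :=
  GRing.isLinear.Build R (M i) (submod (cycles M j)) *:%R (@cdiffZ M i j)
    (@cdiffZ_linear M i j).

Definition boundaries (M : complex) (i : int) :
    submodClosed (submod (cycles M i)) :=
  im_pred (@cdiffZ M (i + 1) i).

Definition homology (M : complex) (i : int) : lmodType R :=
  quotmod (boundaries M i).

Definition acyclic (M : complex) : Prop :=
  forall i, zero_module (homology M i).

Section HomologyMap.
Variables (L M : complex) (f : chain_map L M) (i : int).

Lemma cmap_cycles x : x \in cycles L i -> f i x \in cycles M i.
Proof.
by rewrite !unfold_in cmapC => /eqP->; rewrite linear0.
Qed.

Definition cycles_map : {linear submod (cycles L i) -> submod (cycles M i)} :=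
  submod_map cmap_cycles.

Lemma cmap_boundaries x :
  x \in boundaries L i -> cycles_map x \in boundaries M i.
Proof.
move=> /asboolP[y <-]; apply/asboolP; exists (f (i + 1) y).
by apply: val_inj; rewrite /= cmapC.
Qed.

Definition homology_map : {linear homology L i -> homology M i} :=
  quotmod_map cmap_boundaries.

End HomologyMap.

Definition quasi_iso (L M : complex) (f : chain_map L M) : Prop :=
  forall i, bijective (homology_map f i).

Definition degreewise_fin_gen (L : complex) : Prop :=
  forall i, fin_gen (L i).

Definition bounded_fin_pres (A : complex) : Prop :=
  (exists a b : int, forall i, i < a \/ b < i -> zero_module (A i)) /\
  forall i, fin_pres (A i).

Record subcomplex (M : complex) := Subcomplex {
  sub_at :> forall i, submodClosed (M i);
  sub_cdiff : forall i j x, x \in sub_at i -> cdiff M i j x \in sub_at j }.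

Section SubQuotientComplex.
Variables (M : complex) (S : subcomplex M).

Definition sub_obj (i : int) : lmodType R := submod (S i).
Definition sub_diff i j : {linear sub_obj i -> sub_obj j} :=
  submod_map (@sub_cdiff M S i j).
Lemma sub_diff_shape i j : i != j + 1 -> forall x, sub_diff i j x = 0.
Proof. by move=> ij x; apply: val_inj; rewrite /= cdiff_shape. Qed.
Lemma sub_diff2 i j k x : sub_diff j k (sub_diff i j x) = 0.
Proof. by apply: val_inj; rewrite /= cdiff2. Qed.
Definition sub_complex : complex := Complex sub_diff_shape sub_diff2.

Definition sub_incl : chain_map sub_complex M :=
  @ChainMap sub_complex M (fun i => val) (fun i j x => erefl).

Definition quot_obj (i : int) : lmodType R := quotmod (S i).
Definition quot_diff i j : {linear quot_obj i -> quot_obj j} :=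
  quotmod_map (@sub_cdiff M S i j).
Lemma quot_diffE i j x : quot_diff i j (qproj (S i) x) = qproj (S j) (cdiff M i j x).
Proof. exact: quotmod_mapE. Qed.
Lemma quot_diff_shape i j : i != j + 1 -> forall x, quot_diff i j x = 0.
Proof.
by move=> ij x; rewrite -[x]qreprK quot_diffE cdiff_shape // linear0.
Qed.
Lemma quot_diff2 i j k x : quot_diff j k (quot_diff i j x) = 0.
Proof. by rewrite -[x]qreprK !quot_diffE cdiff2 linear0. Qed.
Definition quot_complex : complex := Complex quot_diff_shape quot_diff2.

Definition quot_proj : chain_map M quot_complex :=
  @ChainMap M quot_complex (fun i => qproj (S i)) quot_diffE.

Definition pure_subcomplex : Prop :=
  forall A : complex, bounded_fin_pres A ->
    [/\ forall h h' : chain_map A sub_complex,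
          (forall i, sub_incl i \o h i =1 sub_incl i \o h' i) ->
          forall i, h i =1 h' i,
        forall k : chain_map A M,
          (forall i, quot_proj i \o k i =1 (fun=> 0)) <->
          exists h : chain_map A sub_complex,
            forall i, sub_incl i \o h i =1 k i &
        forall l : chain_map A quot_complex, exists k : chain_map A M,
          forall i, quot_proj i \o k i =1 l i].

End SubQuotientComplex.

Definition pure_acyclic (M : complex) : Prop :=
  acyclic M /\
  forall i : int,
    pure_exact (val : {linear submod (cycles M i) -> M i})
               (@cdiffZ M i (i - 1)).

Definition pure_minimal (M : complex) : Prop :=
  forall S : subcomplex M,
    pure_subcomplex S -> pure_acyclic (sub_complex S) ->
    forall i x, x \in S i -> x = 0.

(* Elements of degree n of the total Hom complex: the product over i of the
   groups Hom_R(P_i, X_{i+n}), again indexed by all pairs (i, j) and zero off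
   the relevant diagonal. *)
Record hom_elt (P X : complex) (n : int) := HomElt {
  hfun :> forall i j, {linear P i -> X j};
  hfun_shape : forall i j, j != i + n -> forall x, hfun i j x = 0 }.

(* The differential of the total Hom complex on elements of degree n,
   f |-> d^X f - (-1)^n f d^P; its component from P_i to X_j vanishes unless
   j = i + n - 1. *)
Definition hom_diff (P X : complex) (n : int) (f : hom_elt P X n)
    (i j : int) (x : P i) : X j :=
  cdiff X (i + n) j (f i (i + n) x)
  - (-1) ^+ `|n|%N *: f (i - 1) j (cdiff P i (i - 1) x).

Definition hom_acyclic (P X : complex) : Prop :=
  forall (n : int) (f : hom_elt P X n),
    (forall i j (x : P i), hom_diff f j x = 0) ->
    exists g : hom_elt P X (n + 1),
      forall i j (x : P i), hom_diff g j x = f i j x.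

Definition semi_projective (P : complex) : Prop :=
  (forall i, projective (P i)) /\
  forall X : complex, acyclic X -> hom_acyclic P X.

Definition semi_projective_resolution (L M : complex) (p : chain_map L M) :
    Prop :=
  semi_projective L /\ quasi_iso p.

(* The derived category, as the localization of the category of complexes at
   the quasi-isomorphisms: morphisms are formal composites of chain maps and
   formal inverses of quasi-isomorphisms, modulo [der_eq]. *)
Inductive der_hom : complex -> complex -> Type :=
| der_map X Y (f : chain_map X Y) : der_hom X Y
| der_inv X Y (s : chain_map X Y) (qs : quasi_iso s) : der_hom Y X
| der_comp X Y Z (g : der_hom Y Z) (f : der_hom X Y) : der_hom X Z.

Definition der_id (X : complex) : der_hom X X := der_map (id_chain_map X).

Inductive der_eq : forall X Y, der_hom X Y -> der_hom X Y -> Prop :=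
| der_eq_refl X Y (f : der_hom X Y) : der_eq f f
| der_eq_sym X Y (f g : der_hom X Y) : der_eq f g -> der_eq g f
| der_eq_trans X Y (f g h : der_hom X Y) :
    der_eq f g -> der_eq g h -> der_eq f h
| der_eq_comp X Y Z (g g' : der_hom Y Z) (f f' : der_hom X Y) :
    der_eq g g' -> der_eq f f' -> der_eq (der_comp g f) (der_comp g' f')
| der_compA X Y Z W (h : der_hom Z W) (g : der_hom Y Z) (f : der_hom X Y) :
    der_eq (der_comp h (der_comp g f)) (der_comp (der_comp h g) f)
| der_comp_idl X Y (f : der_hom X Y) : der_eq (der_comp (der_id Y) f) f
| der_comp_idr X Y (f : der_hom X Y) : der_eq (der_comp f (der_id X)) f
| der_map_comp X Y Z (g : chain_map Y Z) (f : chain_map X Y)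
    (h : chain_map X Z) :
    (forall i, h i =1 g i \o f i) ->
    der_eq (der_map h) (der_comp (der_map g) (der_map f))
| der_invl X Y (s : chain_map X Y) (qs : quasi_iso s) :
    der_eq (der_comp (der_inv qs) (der_map s)) (der_id X)
| der_invr X Y (s : chain_map X Y) (qs : quasi_iso s) :
    der_eq (der_comp (der_map s) (der_inv qs)) (der_id Y).

Definition derived_iso (X Y : complex) : Prop :=
  exists (f : der_hom X Y) (g : der_hom Y X),
    der_eq (der_comp g f) (der_id X) /\ der_eq (der_comp f g) (der_id Y).

(* Infima and suprema of sets of integers, taken in the extended integers
   \bar int; the first argument of the library's [infimum] and [supremum] is
   the value on the empty set. *)
Definition int_inf (A : set int) : \bar int :=
  infimum +oo%E [set n%:E | n in A]%classic.
Definition int_sup (A : set int) : \bar int :=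
  supremum -oo%E [set n%:E | n in A]%classic.

Definition proj_dim (M : complex) : \bar int :=
  int_inf [set n : int | exists P : complex,
    [/\ semi_projective P, derived_iso M P &
        forall i, n < i -> zero_module (P i)]]%classic.

End Complexes.

(* Main.v *)
From HB Require Import structures.
Require Import Defs.
From mathcomp Require Import all_boot all_order all_algebra.
From mathcomp Require Import boolp classical_sets constructive_ereal zify.

(** Everything rests on an algebraic form of minimality. Call a family s of maps
    L_i -> L_{i+1} a splitting of L if s d s = s and s s = 0. Then e = d s + s d
    is an idempotent chain endomorphism; its image is contractible (s is a
    contraction), its kernel is a complementary subcomplex, and so splittings
    describe the contractible direct summands of L. L is disk-free if its only
    splitting is 0.

    A contractible direct summand is a pure-acyclic pure subcomplex, so every
    pure-minimal complex is disk-free ([pure_minimal_disk_free]). The converse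
    holds when R is left noetherian and L is bounded below and consists of
    finitely generated projectives ([disk_free_pure_minimal]): in the lowest
    degree i where a pure acyclic subcomplex S is nonzero, S_i is a direct
    summand of L_i by purity and d maps S_{i+1} onto S_i, so that the projection
    L_i -> S_i lifts through d and the lift is a nonzero splitting.

    Existence. A bounded below resolution F of M by finitely generated
    projectives is built one degree at a time
    ([fin_gen_projective_resolution]). Splittings of F are ordered like
    idempotents; as the modules F_i are noetherian, chains stabilize in each
    degree, and Zorn's lemma gives a maximal splitting. The kernel of its
    idempotent is disk-free, since a splitting of the kernel could be added to
    the maximal one ([exists_disk_free_kernel]), and it is still a resolution
    of M because the complementary summand is contractible.

    Projective dimension. Let L -> M be a semi-projective resolution with L
    disk-free, and let P be semi-projective, isomorphic to M in the derived
    category and zero in degrees above n. Homotopy classes of maps out of a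
    semi-projective complex send quasi-isomorphisms to bijections, so the
    derived isomorphism is realized by chain maps f : L -> P and g : P -> L with
    1 - g f = d h + h d ([derived_iso_factor]). Above n the composite g f
    vanishes, and a homotopy between the identity and 0 in degree i > n produces
    splittings which force L_i = 0 ([disk_free_bound]). So n bounds the
    projective dimension exactly when it bounds the degrees where L lives. *)

Set Implicit Arguments.
Unset Strict Implicit.
Unset Printing Implicit Defensive.

Import Order.TTheory GRing.Theory Num.Theory.
Local Open Scope ring_scope.

(** * Linear maps, projective modules and noetherian modules *)

Section LinearMaps.
Variable R : pzRingType.

Definition linear_of (V W : lmodType R) (f : V -> W) (lf : linear f) :
  {linear V -> W} := HB.pack f (GRing.isLinear.Build R V W *:%R f lf).

Definition lin_closed (V : lmodType R) (P : V -> Prop) : Prop :=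
  [/\ P 0, forall x y, P x -> P y -> P (x + y) & forall a x, P x -> P (a *: x)].

Section SubOf.
Variables (V : lmodType R) (P : V -> Prop) (P_closed : lin_closed P).
#[using="P_closed"]
Definition sub_of_pred : {pred V} := fun x => `[< P x >].
Lemma sub_of_closed : subsemimod_closed sub_of_pred.
Proof.
case: P_closed => P0 PD PZ; split=> [|a x]; first split=> [|x y].
- exact/asboolP.
- by move=> /asboolP Px /asboolP Py; apply/asboolP/PD.
- by move=> /asboolP Px; apply/asboolP/PZ.
Qed.
HB.instance Definition _ :=
  GRing.isSubmodClosed.Build R V sub_of_pred sub_of_closed.
Definition sub_of : submodClosed V := sub_of_pred.
Lemma sub_ofP x : reflect (P x) (x \in sub_of).
Proof. exact: asboolP. Qed.
End SubOf.

Lemma corestr_linear (V W : lmodType R) (S : submodClosed W)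
  (f : {linear V -> W}) (fS : forall x, f x \in S) :
  linear (fun x => Submod (fS x)).
Proof. by move=> a x y; apply: val_inj; rewrite /= linearP. Qed.
Definition corestr (V W : lmodType R) (S : submodClosed W)
  (f : {linear V -> W}) (fS : forall x, f x \in S) : {linear V -> submod S} :=
  linear_of (corestr_linear fS).

Lemma descend_linear (V W : lmodType R) (S : submodClosed V)
  (f : {linear V -> W}) : (forall x, x \in S -> f x = 0) ->
  linear (fun q : quotmod S => f (qrepr q)).
Proof.
move=> fS a p q.
have fE x : f (qrepr (qproj S x)) = f x.
  by apply/subr0_eq; rewrite -linearB fS //; apply/qproj_eq; rewrite qreprK.
by rewrite -[p]qreprK -[q]qreprK -linearP !fE linearP.
Qed.
Definition descend (V W : lmodType R) (S : submodClosed V)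
  (f : {linear V -> W}) (fS : forall x, x \in S -> f x = 0) :
  {linear quotmod S -> W} := linear_of (descend_linear fS).
Lemma descendE (V W : lmodType R) (S : submodClosed V)
  (f : {linear V -> W}) (fS : forall x, x \in S -> f x = 0) x :
  descend fS (qproj S x) = f x.
Proof.
rewrite /descend /=.
by apply/subr0_eq; rewrite -linearB fS //; apply/qproj_eq; rewrite qreprK.
Qed.

Section Transport.
Variable T : int -> lmodType R.

(** The transport T_i -> T_j along i = j, extended by 0 when i and j differ. With
    this convention it is linear for all i and j, and so it fits the doubly
    indexed families of maps by which complexes are given. *)
Definition ccast_fun (i j : int) : T i -> T j :=
  match i =P j with
  | ReflectT e => fun x => eq_rect i (fun k => T k) x j e
  | ReflectF _ => fun=> 0
  end.
Lemma ccast_linear i j : linear (@ccast_fun i j).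
Proof.
rewrite /ccast_fun => a x y; case: eqP => [e|_]; last by rewrite scaler0 addr0.
by case: j / e.
Qed.
Definition ccast i j : {linear T i -> T j} := linear_of (@ccast_linear i j).
Lemma ccast_id i x : ccast i i x = x.
Proof.
rewrite /ccast /= /ccast_fun; case: eqP => // e.
by rewrite (eq_irrelevance e erefl).
Qed.
Lemma ccast_neq i j x : i != j -> ccast i j x = 0.
Proof. by rewrite /ccast /= /ccast_fun; case: eqP. Qed.
End Transport.
(* Simplification must not expose the case analysis on i = j. *)
#[global] Opaque ccast.

Definition lincomb_fun n (V : lmodType R) (g : 'I_n -> V) (v : 'rV[R]_n) : V :=
  \sum_(i < n) v 0 i *: g i.
Lemma lincomb_linear n (V : lmodType R) (g : 'I_n -> V) :
  linear (lincomb_fun g).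
Proof.
move=> a u v; rewrite /lincomb_fun scaler_sumr -big_split /=.
by apply: eq_bigr => i _; rewrite !mxE scalerDl scalerA.
Qed.
Definition lincomb n (V : lmodType R) (g : 'I_n -> V) : {linear 'rV[R]_n -> V} :=
  linear_of (lincomb_linear g).
Lemma lincombE n (V : lmodType R) (g : 'I_n -> V) a :
  lincomb g (\row_i a i) = \sum_(i < n) a i *: g i.
Proof. by apply: eq_bigr => i _; rewrite mxE. Qed.
Lemma lincomb_comp n (V W : lmodType R) (g : 'I_n -> V) (f : {linear V -> W}) v :
  f (lincomb g v) = lincomb (f \o g) v.
Proof.
rewrite /lincomb /= /lincomb_fun linear_sum.
by apply: eq_bigr => i _; rewrite linearZ.
Qed.
Lemma lin_closed_sum n (V : lmodType R) (P : V -> Prop) (g : 'I_n -> V) a :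
  lin_closed P -> (forall i, P (g i)) -> P (\sum_(i < n) a i *: g i).
Proof. by move=> [P0 PD PZ] Pg; elim/big_ind: _ => // i _; apply: PZ. Qed.

Lemma projective_lift (P V W : lmodType R) (g : {linear V -> W})
    (f : {linear P -> W}) : projective P -> (forall x, exists v, g v = f x) ->
  exists h : {linear P -> V}, forall x, g (h x) = f x.
Proof.
move=> Pproj fg.
have fim x : f x \in (im_pred g : submodClosed W) by apply/asboolP/fg.
have gim v : g v \in (im_pred g : submodClosed W) by apply/asboolP; exists v.
have [|h hE] := Pproj _ _ (corestr gim) (corestr fim).
  move=> [w wS]; have /asboolP[v vE] := wS; exists v.
  exact: val_inj.
by exists h => x; have /(congr1 val) := hE x.
Qed.

Lemma projective_retract (P Q : lmodType R) (i : {linear Q -> P})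
  (r : {linear P -> Q}) : cancel i r -> projective P -> projective Q.
Proof.
move=> ir Pproj V W g f gsurj.
have [//|h hE] := Pproj _ _ g (f \o r : {linear _ -> _}).
by exists (h \o i : {linear _ -> _}) => x; rewrite /= hE /= ir.
Qed.

Lemma projective_free n : projective 'rV[R]_n.
Proof.
move=> V W g f gsurj.
have /choice[x xE] : forall i : 'I_n, exists v, g v = f 'e_i.
  by move=> i; apply: gsurj.
exists (lincomb x) => v; rewrite lincomb_comp.
rewrite [in RHS](row_sum_delta v) linear_sum; apply: eq_bigr => i _.
by rewrite linearZ /= xE.
Qed.

Lemma fin_gen_surj (V W : lmodType R) (f : {linear V -> W}) :
  (forall w, exists v, f v = w) -> fin_gen V -> fin_gen W.
Proof.
move=> fs [n [g gE]]; exists n, (f \o g) => w; have [v <-] := fs w.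
have [a ->] := gE v; exists a; rewrite linear_sum.
by apply: eq_bigr => i _; rewrite linearZ.
Qed.

Lemma fin_gen_free n : fin_gen 'rV[R]_n.
Proof. by exists n, (fun i => 'e_i) => v; exists (v 0); exact: row_sum_delta. Qed.

Definition fin_gen_set (V : lmodType R) (P : V -> Prop) : Prop :=
  exists n (g : 'I_n -> V), (forall i, P (g i)) /\
    forall x, P x -> exists a : 'I_n -> R, x = \sum_(i < n) a i *: g i.

Lemma fin_gen_sub_of (V : lmodType R) (S : submodClosed V) :
  fin_gen (submod S) <-> fin_gen_set (fun x => x \in S).
Proof.
split=> [[n [g gE]]|[n [g [gS gE]]]].
  exists n, (val \o g); split=> [i|x xS]; first exact: valP.
  have [a /(congr1 val) aE] := gE (Submod xS); exists a.
  by rewrite [LHS]aE linear_sum; apply: eq_bigr => i _; rewrite linearZ.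
exists n, (fun i => Submod (gS i)) => x; have [a aE] := gE _ (valP x).
exists a; apply: val_inj; rewrite aE linear_sum; apply: eq_bigr => i _.
by rewrite linearZ.
Qed.

(** Induction on the number of generators: the coefficients of the first
    generator that occur in elements of P form a left ideal, which is finitely
    generated. Elements of P that realize its generators, together with
    generators of the elements of P lying in the span of the other g_i,
    generate P. *)
Lemma noetherian_span (V : lmodType R) n (g : 'I_n -> V) (P : V -> Prop) :
  left_noetherian R -> lin_closed P ->
  (forall x, P x -> exists a : 'I_n -> R, x = \sum_(i < n) a i *: g i) ->
  fin_gen_set P.
Proof.
move=> Rn; elim: n g P => [|n IHn] g P Pcl Pg.
  exists 0%N, (fun _ => 0); split=> [[]//|x Px].
  by have [a ->] := Pg x Px; exists a; rewrite !big_ord0.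
pose g' (i : 'I_n) := g (lift ord0 i).
pose sp x := exists a : 'I_n -> R, x = \sum_(i < n) a i *: g' i.
have spcl : lin_closed sp.
  split.
  - by exists (fun=> 0); rewrite big1 // => i _; rewrite scale0r.
  - move=> x y [a ->] [b ->]; exists (fun i => a i + b i).
    by rewrite -big_split; apply: eq_bigr => i _; rewrite scalerDl.
  - move=> c x [a ->]; exists (fun i => c * a i); rewrite scaler_sumr.
    by apply: eq_bigr => i _; rewrite scalerA.
have [sp0 spD spZ] := spcl; have [P0 PD PZ] := Pcl.
pose I (a : R) := exists x, P x /\ sp (x - a *: g ord0).
have Icl : @lin_closed R^o I.
  split.
  - by exists 0; rewrite scale0r subr0.
  - move=> a b [x [Px xs]] [y [Py ys]]; exists (x + y); split; first exact: PD.
    by rewrite scalerDl opprD addrACA; apply: spD.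
  - move=> c a [x [Px xs]]; exists (c *: x); split; first exact: PZ.
    by rewrite /= -scalerA -scalerBr; apply: spZ.
have /fin_gen_sub_of[m [b [bI bE]]] := Rn (sub_of Icl).
pose b' i : R := b i.
have /choice[x xE] : forall i, exists x, P x /\ sp (x - b' i *: g ord0).
  by move=> i; apply/(sub_ofP Icl)/bI.
have [||k [h [hP hE]]] := IHn g' (fun x => P x /\ sp x).
- split=> [//|u v [? ?] [? ?]|c u [? ?]]; split; auto.
- by move=> u [].
exists (m + k)%N, (fun i => match split i with inl i => x i | inr i => h i end).
split=> [i|u Pu]; first by case: split => j; [case: (xE j)|case: (hP j)].
have [a aE] := Pg u Pu.
have aI : I (a ord0).
  exists u; split=> //; exists (a \o lift ord0).
  by apply: (canLR (addrK _)); rewrite aE big_ord_recl addrC.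
have /(bE _)[c /= cE] : a ord0 \in sub_of Icl by apply/(sub_ofP Icl).
pose w := \sum_(i < m) c i *: x i.
have Pw : P w by apply: lin_closed_sum => // i; case: (xE i).
have [|e eE] := hE (u - w).
  split; first by rewrite -scaleN1r; apply: PD => //; apply: PZ.
  have -> : u - w = (u - a ord0 *: g ord0) - (w - a ord0 *: g ord0).
    by rewrite opprB addrA subrK.
  rewrite -(scaleN1r (w - _)); apply: spD.
    exists (a \o lift ord0); apply: (canLR (addrK _)).
    by rewrite aE big_ord_recl addrC.
  apply: spZ; have {}cE : a ord0 = \sum_(i < m) c i * b' i by rewrite cE.
  rewrite cE scaler_suml /w -sumrB.
  have -> : \sum_(i < m) (c i *: x i - (c i * b' i) *: g ord0) =
            \sum_(i < m) c i *: (x i - b' i *: g ord0).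
    by apply: eq_bigr => i _; rewrite scalerBr scalerA.
  by apply: lin_closed_sum => // i; case: (xE i).
exists (fun i => match split i with inl i => c i | inr i => e i end).
rewrite big_split_ord /= -[LHS](subrK w) [LHS]addrC; congr (_ + _).
  by apply: eq_bigr => i _; rewrite (unsplitK (inl i)).
by rewrite eE; apply: eq_bigr => i _; rewrite (unsplitK (inr i)).
Qed.

Lemma noetherian_fin_gen (V : lmodType R) (P : V -> Prop) :
  left_noetherian R -> fin_gen V -> lin_closed P -> fin_gen_set P.
Proof. by move=> Rn [n [g gE]] Pcl; apply: (noetherian_span (g := g)). Qed.

Lemma noetherian_submod (V : lmodType R) (S : submodClosed V) :
  left_noetherian R -> fin_gen V -> fin_gen (submod S).
Proof.
move=> Rn Vfg; apply/fin_gen_sub_of/noetherian_fin_gen => //.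
by split=> [|x y xS yS|a x xS]; [exact: rpred0|exact: rpredD|exact: rpredZ].
Qed.

Lemma noetherian_fin_pres (V : lmodType R) :
  left_noetherian R -> fin_gen V -> fin_pres V.
Proof.
move=> Rn [n [g gE]]; exists n, (lincomb g); split.
  by move=> x; have [a ->] := gE x; exists (\row_i a i); rewrite lincombE.
by apply: noetherian_submod => //; apply: fin_gen_free.
Qed.

(** The ascending chain condition, for chains with an arbitrary index set: the
    union of the chain is finitely generated, so a single member contains all
    its generators. *)
Lemma noetherian_chain (V : lmodType R) (I : Type) (A : set I) (P : I -> V -> Prop) :
  left_noetherian R -> fin_gen V -> (forall c, lin_closed (P c)) ->
  (exists c, A c) ->
  (forall c c', A c -> A c' ->
     (forall x, P c x -> P c' x) \/ (forall x, P c' x -> P c x)) ->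
  exists c, A c /\ forall c', A c' -> forall x, P c' x -> P c x.
Proof.
move=> Rn Vfg Pcl [c0 Ac0] Atot.
have [|n [g [gU gE]]] := @noetherian_fin_gen V (fun x => exists c, A c /\ P c x) Rn Vfg.
  split.
  - by exists c0; split=> //; case: (Pcl c0).
  - move=> x y [c [Ac cx]] [c' [Ac' cy]].
    have [cc'|cc'] := Atot c c' Ac Ac'.
      by exists c'; split=> //; case: (Pcl c') => _ D _; apply: D => //; apply: cc'.
    by exists c; split=> //; case: (Pcl c) => _ D _; apply: D => //; apply: cc'.
  - by move=> a x [c [Ac cx]]; exists c; split=> //; case: (Pcl c) => _ _; apply.
suff [c [Ac cg]] : exists c, A c /\ forall i : 'I_n, P c (g i).
  exists c; split=> // c' Ac' x c'x; have [|a ->] := gE x; first by exists c'.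
  exact: lin_closed_sum.
elim: n g gU {gE} => [|n IHn] g gU; first by exists c0; split=> // [[]].
have [c [Ac cg]] := IHn (g \o lift ord0) (fun i => gU _).
have [c' [Ac' c'g]] := gU ord0.
have [cc'|cc'] := Atot c c' Ac Ac'.
  exists c'; split=> // i; have [j ->|->//] := unliftP ord0 i.
  exact/cc'/cg.
exists c; split=> // i; have [j ->|->] := unliftP ord0 i; first exact: cg.
exact: cc'.
Qed.

End LinearMaps.

(** Dependent choice along the integers, starting from a given family below n0.
    The successive approximations are whole families, each changing the previous
    one in a single degree; this keeps the dependent types T_i free of
    transports. *)
Lemma int_dep_choice (T : int -> Type) (G : forall i, T i -> Prop)
    (Rel : forall i : int, T (i - 1) -> T i -> Prop) (n0 : int)
    (t0 : forall i, T i) :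
  (forall i : int, i < n0 -> G i (t0 i)) ->
  (forall i : int, i < n0 -> Rel i (t0 (i - 1)) (t0 i)) ->
  (forall (i : int) t, n0 <= i -> G (i - 1) t -> exists t', G i t' /\ Rel i t t') ->
  exists t : forall i, T i,
    (forall i, G i (t i)) /\ forall i, Rel i (t (i - 1)) (t i).
Proof.
move=> G0 R0 step.
pose good (k : nat) (t : forall i, T i) := forall i : int, i < n0 + k%:Z ->
  G i (t i) /\ Rel i (t (i - 1)) (t i).
have nextP k t : exists t', good k t -> good k.+1 t' /\
    forall i : int, i < n0 + k%:Z -> t' i = t i.
  have [gt|ngt] := pselect (good k t); last by exists t.
  set i0 := n0 + k%:Z.
  have Gp : G (i0 - 1) (t (i0 - 1)) by apply: (gt _ _).1; rewrite /i0; lia.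
  have [|t' [Gt' Rt']] := step i0 (t (i0 - 1)) _ Gp; first by rewrite /i0; lia.
  exists (dfwith t t') => _; split=> [i ik|i ik]; last first.
    by rewrite dfwith_out //; rewrite eq_sym lt_eqF.
  rewrite (@dfwith_out _ _ _ i0 _ (i - 1)); last by apply/eqP; rewrite /i0; lia.
  have [ei|ne] := eqVneq i i0; first by rewrite ei dfwith_in.
  rewrite dfwith_out; last by rewrite eq_sym.
  by apply: gt; move/eqP: ne; rewrite /i0; lia.
have /choice[f fP] : forall kt : nat * (forall i, T i), exists t',
    good kt.1 kt.2 -> good kt.1.+1 t' /\
    forall i : int, i < n0 + kt.1%:Z -> t' i = kt.2 i.
  by case=> k t; apply: nextP.
pose st := fix st k := if k is k'.+1 then f (k', st k') else t0.
have gst k : good k (st k).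
  elim: k => [|k IHk]; last exact: (fP (k, st k) IHk).1.
  by move=> i; rewrite addr0 => ik; split; [apply: G0|apply: R0].
have stable k l (i : int) : i < n0 + k%:Z -> st (k + l)%N i = st k i.
  move=> ik; elim: l => [|l IHl]; first by rewrite addn0.
  rewrite addnS -IHl; apply: (fP (_, st (k + l)%N) (gst _)).2 => /=.
  by lia.
(* At stage N i the component in degree i has reached its final value. *)
pose N (i : int) := absz (i - n0 + 1).
have Nlt (i : int) : i < n0 + (N i)%:Z by rewrite /N; lia.
have stE k (i : int) : i < n0 + k%:Z -> st k i = st (N i) i.
  move=> ik; rewrite -(stable k (N i)) // -(stable (N i) k) //.
  by rewrite addnC.
exists (fun i => st (N i) i); split=> i; first exact: (gst _ _ (Nlt i)).1.
have := (gst _ _ (Nlt i)).2; rewrite (stE (N i) (i - 1)) //.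
by have := Nlt i; lia.
Qed.

(** * Homology in terms of elements *)

Section Homology.
Variable R : pzRingType.
Implicit Types L M : complex R.

Definition is_cycle M i (x : M i) : Prop := forall j, cdiff M i j x = 0.
Arguments is_cycle : clear implicits.

Lemma cycleP M i (x : M i) : x \in cycles M i <-> is_cycle M i x.
Proof.
split=> [|xc]; last by rewrite unfold_in xc.
rewrite unfold_in => /eqP x0 j.
have [ij|ij] := eqVneq i (j + 1); last exact: cdiff_shape.
by have -> : j = i - 1 by rewrite ij addrK.
Qed.

Lemma boundariesP M i (x : submod (cycles M i)) :
  x \in boundaries M i <-> exists y : M (i + 1), cdiff M (i + 1) i y = val x.
Proof.
split=> [/asboolP[y yx]|[y yx]]; first by exists y; rewrite -yx.
by apply/asboolP; exists y; apply: val_inj.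
Qed.

Lemma qproj_eq0 (V : lmodType R) (S : submodClosed V) x :
  qproj S x = 0 <-> x \in S.
Proof. by rewrite -[0](linear0 (qproj S)) qproj_eq subr0. Qed.

Lemma homology0P M i : zero_module (homology M i) <->
  forall x : M i, is_cycle M i x -> exists y : M (i + 1), cdiff M (i + 1) i y = x.
Proof.
split=> [H0 x /cycleP xc|H x].
  by have /qproj_eq0/boundariesP := H0 (qproj (boundaries M i) (Submod xc)).
rewrite -[x]qreprK; apply/qproj_eq0/boundariesP/H/cycleP.
exact: valP.
Qed.

Lemma acyclicP M : acyclic M <->
  forall i j (x : M j), i = j + 1 -> is_cycle M j x ->
    exists y : M i, cdiff M i j y = x.
Proof.
split=> [Mac i j x -> xc|H i]; first exact: (homology0P M j).1.
by apply/homology0P => x; apply: H.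
Qed.

Lemma quasi_isoP L M (f : chain_map L M) : quasi_iso f <->
  (forall i j (x : L j), i = j + 1 -> is_cycle L j x ->
     (exists y : M i, cdiff M i j y = f j x) ->
     exists y : L i, cdiff L i j y = x) /\
  (forall i j (z : M j), i = j + 1 -> is_cycle M j z ->
     exists2 x : L j, is_cycle L j x &
       exists y : M i, cdiff M i j y = f j x - z).
Proof.
have hE j (x : submod (cycles L j)) :
    homology_map f j (qproj _ x) = qproj _ (cycles_map f j x).
  exact: (quotmod_mapE (@cmap_boundaries R L M f j)).
split=> [qf|[finj fsurj] j].
  split=> [i j x -> /cycleP xc yx|i j z -> /cycleP zc].
    have : qproj (boundaries L j) (Submod xc) = 0.
      apply: (bij_inj (qf j)); rewrite linear0 hE.
      by apply/qproj_eq0/boundariesP.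
    by move/qproj_eq0/boundariesP.
  have [g _ gK] := qf j.
  pose q := g (qproj (boundaries M j) (Submod zc)).
  exists (val (qrepr q)); first exact/cycleP/valP.
  have : homology_map f j q = qproj _ (Submod zc) by exact: gK.
  by rewrite -[q in LHS]qreprK hE => /qproj_eq/boundariesP.
have hinj : injective (homology_map f j).
  move=> p q /eqP; rewrite -subr_eq0 -linearB => /eqP.
  rewrite -[p - q]qreprK hE => /qproj_eq0/boundariesP yx.
  apply/eqP; rewrite -subr_eq0 -[p - q]qreprK; apply/eqP/qproj_eq0/boundariesP.
  by apply: finj => //; apply/cycleP/valP.
have /choice[g gK] : forall q, exists p, homology_map f j p = q.
  move=> q; rewrite -[q]qreprK.
  have /cycleP/(fsurj _ _ _ erefl)[x /cycleP xc [y yE]] := valP (qrepr q).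
  exists (qproj _ (Submod xc)); rewrite hE; apply/qproj_eq/boundariesP.
  by exists y.
by exists g => // p; apply: hinj; rewrite gK.
Qed.

End Homology.
Arguments is_cycle {R} M i x.

(** * Splittings and contractible summands *)

Section Splittings.
Variable R : pzRingType.
Implicit Types L : complex R.

(** Maps between all pairs of components; only those from L_i to M_{i+1} matter,
    and the double index avoids transports. *)
Definition hfamily L M := forall i j, {linear (L : complex R) i -> (M : complex R) j}.

(** The first equation makes s i j vanish unless j = i + 1, since then
    the differential from L_j to L_i is zero. *)
Definition splitting L (s : hfamily L L) : Prop :=
  (forall i j x, s i j (cdiff L j i (s i j x)) = s i j x) /\
  (forall i j k x, s j k (s i j x) = 0).

(** A disk is a complex concentrated in two consecutive degrees, with an
    isomorphism as differential. Every contractible complex is a direct sum of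
    disks, so the absence of disk summands is the absence of contractible ones. *)
Definition disk_free L : Prop :=
  forall s : hfamily L L, splitting s -> forall i j x, s i j x = 0.

Section Idempotent.
Variables (L : complex R) (s : hfamily L L).

Lemma idem_linear i : linear (fun x : L i =>
  cdiff L (i + 1) i (s i (i + 1) x) + s (i - 1) i (cdiff L i (i - 1) x)).
Proof.
move=> a x y; rewrite !linearP scalerDr -!addrA; congr (_ + _).
by rewrite addrCA.
Qed.
Definition idem i : {linear L i -> L i} := linear_of (@idem_linear i).

(** The indices j and k are free, which allows rewriting with neighbouring
    degrees that are not written as i + 1 and i - 1. *)
Lemma idemE i j k x : j = i + 1 -> i = k + 1 ->
  idem i x = cdiff L j i (s i j x) + s k i (cdiff L i k x).
Proof.
move=> -> ik; have -> : k = i - 1 by rewrite ik addrK.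
by [].
Qed.

Hypothesis ss : splitting s.

Lemma sds i j x : s i j (cdiff L j i (s i j x)) = s i j x.
Proof. exact: ss.1. Qed.
Lemma sss i j k x : s j k (s i j x) = 0.
Proof. exact: ss.2. Qed.

Lemma splitting_shape i j x : j != i + 1 -> s i j x = 0.
Proof. by move=> ij; rewrite -sds cdiff_shape // linear0. Qed.

Lemma idem_s i j x : idem j (s i j x) = s i j x.
Proof.
have [ji|ji] := eqVneq j (i + 1); last by rewrite splitting_shape // linear0.
by rewrite (idemE _ erefl ji) sss linear0 add0r sds.
Qed.
Lemma s_idem i j x : s i j (idem i x) = s i j x.
Proof.
have [ji|ji] := eqVneq j (i + 1); last by rewrite !splitting_shape.
by rewrite (@idemE i j (i - 1)) ?subrK // linearD sds sss addr0.
Qed.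
Lemma idem_ds i j x : idem i (cdiff L j i (s i j x)) = cdiff L j i (s i j x).
Proof.
have [ji|ji] := eqVneq j (i + 1); last first.
  by rewrite splitting_shape // !linear0.
by rewrite (@idemE i j (i - 1)) ?subrK // sds cdiff2 linear0 addr0.
Qed.
Lemma sd_idem i j x : s i j (cdiff L j i (idem j x)) = s i j (cdiff L j i x).
Proof.
have [ji|ji] := eqVneq j (i + 1); last by rewrite !splitting_shape.
by rewrite (idemE _ erefl ji) linearD cdiff2 add0r sds.
Qed.
Lemma d_idem i j x : cdiff L i j (idem i x) = idem j (cdiff L i j x).
Proof.
have [ij|ij] := eqVneq i (j + 1); last by rewrite !cdiff_shape // linear0.
rewrite (idemE _ erefl ij) (@idemE j i (j - 1)) ?subrK // linearD cdiff2 add0r.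
by rewrite cdiff2 linear0 addr0.
Qed.
Lemma idemK i x : idem i (idem i x) = idem i x.
Proof.
rewrite (@idemE i (i + 1) (i - 1) x) ?subrK //.
by rewrite linearD idem_ds idem_s.
Qed.

Definition coidem i : {linear L i -> L i} := idfun \- idem i.
Lemma coidemE i x : coidem i x = x - idem i x. Proof. by []. Qed.
Lemma coidem_d i j x : cdiff L i j (coidem i x) = coidem j (cdiff L i j x).
Proof. by rewrite !coidemE linearB d_idem. Qed.
Lemma idem_coidem i x : idem i (coidem i x) = 0.
Proof. by rewrite coidemE linearB idemK subrr. Qed.

Lemma idem_sub i j x : x \in ker_pred (idem i) -> cdiff L i j x \in ker_pred (idem j).
Proof. by rewrite !unfold_in -d_idem => /eqP->; rewrite linear0. Qed.
Definition idem_ker : subcomplex L := Subcomplex idem_sub.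
Lemma idem_kerP i x : x \in idem_ker i <-> idem i x = 0.
Proof. by split=> [/eqP|/eqP]. Qed.

Lemma coidem_sub i j x :
  x \in ker_pred (coidem i) -> cdiff L i j x \in ker_pred (coidem j).
Proof. by rewrite !unfold_in -coidem_d => /eqP->; rewrite linear0. Qed.
Definition idem_im : subcomplex L := Subcomplex coidem_sub.
Lemma idem_imP i x : x \in idem_im i <-> idem i x = x.
Proof.
split=> [/eqP|xi]; first by rewrite coidemE => /subr0_eq.
by apply/eqP; rewrite coidemE xi subrr.
Qed.

End Idempotent.
End Splittings.

(** * Homotopies *)

Section Homotopies.
Variable R : pzRingType.
Implicit Types L M N : complex R.

Definition homotopy L M (h : hfamily L M) (u : forall i, L i -> M i) : Prop :=
  forall i j k x, j = i + 1 -> i = k + 1 ->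
    u i x = cdiff M j i (h i j x) + h k i (cdiff L i k x).

Definition contractible L : Prop :=
  exists h : hfamily L L, homotopy h (fun i x => x).

Lemma split_pure_exact (U V W : lmodType R) (f : {linear U -> V})
    (g : {linear V -> W}) (r : {linear V -> U}) (t : {linear W -> V}) :
  (forall v, g v = 0 <-> exists u, f u = v) ->
  cancel f r -> cancel t g -> (forall v, f (r v) + t (g v) = v) ->
  pure_exact f g.
Proof.
move=> fg fr tg frtg; split=> [|A _].
  split=> [||w]; [exact: can_inj fr|exact: fg|].
  by exists (t w).
split=> [h h' hh' x|k|l].
- by apply: (can_inj fr); apply: hh'.
- split=> [gk|[h hk] x].
    exists (r \o k : {linear _ -> _}) => x /=.
    by have := frtg (k x); rewrite [g _]gk linear0 addr0.
  by apply/fg; exists (h x); apply: hk.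
- by exists (t \o l : {linear _ -> _}) => x /=; rewrite tg.
Qed.

(** For a contraction h, the inclusion Z_i -> L_i is split by d h and the
    corestricted differential L_i -> Z_{i-1} by h. *)
Lemma contractible_pure_acyclic L : contractible L -> pure_acyclic L.
Proof.
move=> [h hE]; split.
  apply/acyclicP => i j x ij xc; exists (h j i x).
  by rewrite [RHS](@hE _ _ (j - 1) _ ij) ?subrK // xc linear0 addr0.
move=> i.
have hid x : x = cdiff L (i + 1) i (h i (i + 1) x) + h (i - 1) i (cdiff L i (i - 1) x).
  by apply: hE; rewrite ?subrK.
pose r : {linear L i -> submod (cycles L i)} :=
  (@cdiffZ R L (i + 1) i : {linear _ -> _}) \o h i (i + 1).
pose t : {linear submod (cycles L (i - 1)) -> L i} :=
  h (i - 1) i \o (val : {linear submod (cycles L (i - 1)) -> L (i - 1)}).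
apply: (@split_pure_exact _ _ _ _ _ r t) => [v|u|w|v].
- split=> [/(congr1 val)/= v0|[[u uc] <-]].
    have vc : v \in cycles L i by rewrite unfold_in v0.
    by exists (Submod vc).
  by apply: val_inj; apply/eqP.
- apply: val_inj; rewrite /= [RHS]hid; case: u => u /= /eqP->.
  by rewrite linear0 addr0.
- apply: val_inj => /=; have /cycleP wc := valP w.
  by rewrite [RHS](@hE _ i (i - 1 - 1)) ?subrK // wc linear0 addr0.
- by rewrite [RHS]hid.
Qed.

(** A chain map A -> M/S lifts to M along the section q |-> x - r x of the
    projection, where x is any representative of q. *)
Lemma retract_pure M (S : subcomplex M) (r : chain_map M M) :
  (forall i x, r i x \in S i) -> (forall i x, x \in S i -> r i x = x) ->
  pure_subcomplex S.
Proof.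
move=> rS rid A _; split=> [h h' hh' i x|k|l].
- by apply: val_inj; apply: hh'.
- split=> [k0|[h hk] i x]; last first.
    by apply/qproj_eq0; rewrite -hk; apply: valP.
  have kS i x : k i x \in S i by apply/qproj_eq0/k0.
  have kC i j (x : A i) : cdiff (sub_complex S) i j (corestr (kS i) x) =
      corestr (kS j) (cdiff A i j x).
    by apply: val_inj; apply: cmapC.
  by exists (ChainMap kC).
have dS i x : x \in S i -> (idfun \- r i) x = 0.
  by move=> xS; rewrite /= rid // subrr.
have kC i j x : cdiff M i j ((descend (@dS i) \o l i) x) =
    (descend (@dS j) \o l j) (cdiff A i j x).
  change (cdiff M i j (descend (@dS i) (l i x)) =
          descend (@dS j) (l j (cdiff A i j x))).
  rewrite -cmapC -[l i x]qreprK quot_diffE !descendE /=.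
  by rewrite linearB cmapC.
exists (ChainMap kC) => i x /=; rewrite -[RHS]qreprK.
by apply/qproj_eq; rewrite addrAC subrr add0r -scaleN1r rpredZ //; apply: rS.
Qed.

Lemma sub_family M (S : subcomplex M) (h : hfamily M M) :
  (forall i j x, x \in S i -> h i j x \in S j) ->
  hfamily (sub_complex S) (sub_complex S).
Proof. move=> hS i j; exact: (submod_map (@hS i j)). Defined.

Section IdemImage.
Variables (L : complex R) (s : hfamily L L) (ss : splitting s).

Lemma idem_im_pure : pure_subcomplex (idem_im s).
Proof.
have eC i j x : cdiff L i j (idem s i x) = idem s j (cdiff L i j x).
  exact: d_idem.
apply: (@retract_pure _ _ (ChainMap eC)) => i x /=; last by move/idem_imP.
by apply/idem_imP; apply: idemK.
Qed.

Lemma idem_im_contractible : contractible (sub_complex (idem_im s)).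
Proof.
have sS i j x : x \in idem_im s i -> s i j x \in idem_im s j.
  by move=> _; apply/idem_imP/idem_s.
exists (sub_family sS) => i j k x ji ik; apply: val_inj => /=.
by rewrite -(idemE _ _ ji ik); apply/esym/idem_imP/valP.
Qed.

End IdemImage.

(** The image of the idempotent of s is a pure-acyclic pure subcomplex which
    contains all values of s. *)
Lemma pure_minimal_disk_free L : pure_minimal L -> disk_free L.
Proof.
move=> Lmin s ss i j x.
apply: (Lmin _ (idem_im_pure ss)); last exact/idem_imP/idem_s.
exact/contractible_pure_acyclic/idem_im_contractible.
Qed.

(** Extended by zero, a single map s with s d s = s is a splitting: the other
    condition s s = 0 holds for reasons of degree. *)
Lemma disk_free_single L i j (s : {linear L i -> L j}) :
  disk_free L -> (forall x, s (cdiff L j i (s x)) = s x) -> forall x, s x = 0.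
Proof.
move=> Lfree sE x.
pose S : hfamily L L := fun a b => ccast L j b \o (s \o ccast L a i).
have SE a b (y : L a) : S a b y = ccast L j b (s (ccast L a i y)) by [].
have S0 a b (y : L a) : (a != i) || (b != j) -> S a b y = 0.
  rewrite SE => /orP[ne|ne]; first by rewrite (ccast_neq _ ne) !linear0.
  by rewrite ccast_neq // eq_sym.
have Sij y : S i j y = s y by rewrite SE !ccast_id.
suff SS : splitting S by rewrite -Sij Lfree.
split=> [a b y|a b c y].
  have [ne|] := boolP ((a != i) || (b != j)); first by rewrite !S0.
  rewrite negb_or !negbK => /andP[/eqP ai /eqP bj]; subst a b.
  by rewrite !Sij sE.
have [ne|] := boolP ((a != i) || (b != j)); first by rewrite (S0 a b) // linear0.
rewrite negb_or !negbK => /andP[/eqP ai /eqP bj]; subst a b.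
have [ji|ji] := eqVneq j (i + 1); first by rewrite S0 // ji -subr_eq0 addrC addKr.
by rewrite Sij -sE cdiff_shape // !linear0.
Qed.

(** In a degree i > n the identity of L_i is d h + h d. Put k = i - 1 and let a be
    the component L_k -> L_i of h. Then d a d = d on L_i, so a d a is a splitting
    and vanishes, whence d = d (a d a) d = 0 on L_i. Now the identity of L_i is
    d h, so the component of h on L_i is a splitting too, and it vanishes. *)
Lemma disk_free_bound L (u : forall i, L i -> L i) (h : hfamily L L) (n : int) :
  disk_free L -> homotopy h (fun i x => x - u i x) ->
  (forall i x, n < i -> u i x = 0) -> forall i, n < i -> zero_module (L i).
Proof.
move=> Lfree hE u0 i ni x.
pose k := i - 1; pose j := i + 1.
have ik : i = k + 1 by rewrite /k subrK.
have hid (y : L i) : y = cdiff L j i (h i j y) + h k i (cdiff L i k y).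
  by rewrite -hE // u0 // subr0.
pose a := h k i : {linear _ -> _}.
have dad y : cdiff L i k (a (cdiff L i k y)) = cdiff L i k y.
  by rewrite [in RHS](hid y) linearD cdiff2 add0r.
pose s : {linear L k -> L i} := a \o (cdiff L i k \o a).
have s0 : forall y, s y = 0.
  by apply: disk_free_single => // y; rewrite /s /= !dad.
have d0 y : cdiff L i k y = 0.
  rewrite -dad -[in LHS]dad.
  by have := s0 (cdiff L i k y); rewrite /s /= => ->; rewrite linear0.
have h0 y : h i j y = 0.
  apply: disk_free_single => // z.
  by rewrite {2}(hid z) d0 linear0 addr0.
by rewrite (hid x) d0 h0 !linear0 addr0.
Qed.

End Homotopies.

(** * Maximal splittings *)

(** The complementary summand of the image of the idempotent. *)
Section Kernel.
Variables (R : pzRingType) (L : complex R) (s : hfamily L L).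
Hypothesis ss : splitting s.
Let K := sub_complex (idem_ker s).

Lemma coidem_ker i x : coidem s i x \in idem_ker s i.
Proof. by apply/idem_kerP; apply: idem_coidem. Qed.
Definition ker_proj i : {linear L i -> K i} := corestr (@coidem_ker i).

Lemma val_ker_proj i x : val (ker_proj i x) = x - idem s i x.
Proof. by []. Qed.

Lemma idem_val i (x : K i) : idem s i (val x) = 0.
Proof. exact/idem_kerP/valP. Qed.

Lemma ker_projK i : cancel (val : K i -> L i) (ker_proj i).
Proof. by move=> x; apply: val_inj; rewrite val_ker_proj idem_val subr0. Qed.

Lemma ker_proj0 i x : idem s i x = x -> ker_proj i x = 0.
Proof. by move=> xi; apply: val_inj; rewrite val_ker_proj xi subrr. Qed.

Lemma ker_proj_d i j x : ker_proj j (cdiff L i j x) = cdiff K i j (ker_proj i x).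
Proof.
apply: val_inj; rewrite val_ker_proj -d_idem -linearB.
by [].
Qed.

Lemma ker_projective i : projective (L i) -> projective (K i).
Proof.
exact: (@projective_retract _ (L i) (K i) (val : {linear K i -> L i}) _ (@ker_projK i)).
Qed.

Lemma ker_fin_gen i : fin_gen (L i) -> fin_gen (K i).
Proof.
by apply: (@fin_gen_surj _ _ _ (ker_proj i)) => x; exists (val x); apply: ker_projK.
Qed.

(** The inclusion of the kernel of the idempotent e is a quasi-isomorphism: it has
    the retraction 1 - e, and e x = d s x for every cycle x. *)
Lemma ker_quasi_iso M (p : chain_map L M) : quasi_iso p ->
  exists q : chain_map K M, quasi_iso q.
Proof.
move=> /quasi_isoP[pinj psurj].
have qC i j (x : K i) : cdiff M i j ((p i \o val) x) = (p j \o val) (cdiff K i j x).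
  by rewrite /= cmapC.
exists (ChainMap qC); apply/quasi_isoP; split=> [i j x ij xc [y yE]|i j z ij zc].
  have [|w wE] := pinj i j (val x) ij _ (ex_intro _ y yE).
    by move=> k; have /(congr1 val) := xc k.
  exists (ker_proj i w); rewrite -ker_proj_d wE; apply: val_inj.
  by rewrite val_ker_proj idem_val subr0.
have [x xc [y yE]] := psurj i j z ij zc.
exists (ker_proj j x) => [k|]; first by rewrite -ker_proj_d xc linear0.
exists (y - p i (s j i x)); rewrite linearB yE cmapC.
rewrite [RHS](_ : _ = p j (x - idem s j x) - z) //.
rewrite (@idemE _ _ s j i (j - 1)) ?subrK // xc linear0 addr0 linearB.
by rewrite addrAC.
Qed.

(** A splitting of the kernel extends by zero to one that is orthogonal to s, and
    so can be added to s. *)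
Lemma splitting_extend (T : hfamily K K) : splitting T ->
  let t : hfamily L L := fun i j => val \o (T i j \o ker_proj i) in
  let s' : hfamily L L := fun i j => s i j \+ t i j in
  [/\ splitting s',
      forall i j x, s i j (cdiff L j i (s' i j x)) = s i j x &
      forall i j x, s' i j (cdiff L j i (s i j x)) = s i j x].
Proof.
move=> [TdT TT] t s'.
have tE i j x : t i j x = val (T i j (ker_proj i x)) by [].
have s'E i j x : s' i j x = s i j x + t i j x by [].
have sdt i j x : s i j (cdiff L j i (t i j x)) = 0.
  by rewrite -sd_idem // tE idem_val !linear0.
have tds i j x : t i j (cdiff L j i (s i j x)) = 0.
  by rewrite tE ker_proj0 ?idem_ds // !linear0.
have st i j k x : s j k (t i j x) = 0.
  by rewrite -(s_idem ss) tE idem_val linear0.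
have ts i j k x : t j k (s i j x) = 0.
  by rewrite tE ker_proj0 ?idem_s // !linear0.
have tdt i j x : t i j (cdiff L j i (t i j x)) = t i j x.
  by rewrite !tE ker_proj_d ker_projK TdT.
have tt i j k x : t j k (t i j x) = 0 by rewrite !tE ker_projK TT linear0.
split=> [|i j x|i j x].
- split=> [i j x|i j k x].
    by rewrite !s'E !linearD (sds ss) sdt tds tdt addr0 add0r.
  by rewrite !s'E !linearD (sss ss) st ts tt !addr0.
- by rewrite s'E !linearD (sds ss) sdt addr0.
- by rewrite s'E (sds ss) tds addr0.
Qed.

End Kernel.

Section Minimality.
Variable R : pzRingType.
Hypothesis R_noeth : left_noetherian R.

(** Splittings are idempotents for the product s * t = s d t, and are ordered by
    s <= s' iff s * s' = s = s' * s. Along a chain the submodules d s L_i of the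
    noetherian module L_i increase, hence stabilize, and once the submodule is
    stable so is s in that degree. The stable values in the various degrees form
    an upper bound; Zorn's lemma applies. *)
Lemma exists_disk_free_kernel (L : complex R) : degreewise_fin_gen L ->
  exists2 s : hfamily L L, splitting s & disk_free (sub_complex (idem_ker s)).
Proof.
move=> Lfg.
pose T := {s : hfamily L L | splitting s}.
pose le (s s' : T) : Prop := forall i j x,
  sval s i j (cdiff L j i (sval s' i j x)) = sval s i j x /\
  sval s' i j (cdiff L j i (sval s i j x)) = sval s i j x.
have le_refl s : le s s by move=> i j x; rewrite (sds (svalP s)).
have le_trans a b c : le a b -> le b c -> le a c.
  move=> ab bc i j x; split.
    by rewrite -(ab i j _).1 (bc i j x).1 (ab i j x).1.
  by rewrite -{1}(ab i j x).2 (bc i j _).2 (ab i j x).2.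
have sp0 : splitting (fun i j => \0 : {linear L i -> L j}) by split.
pose s0 : T := exist _ _ sp0.
have chain A : total_on A (fun a b => `[< le a b >]) ->
    exists t, forall c, A c -> `[< le c t >].
  move=> Atot.
  have [[c0 Ac0]|A0] := pselect (exists c, A c); last first.
    by exists s0 => c Ac; case: A0; exists c.
  have {}Atot a b : A a -> A b -> le a b \/ le b a.
    by move=> Aa Ab; have [/asboolP|/asboolP] := Atot a b Aa Ab; [left|right].
  (* A member of the chain whose (i, j) component is stable. *)
  have cP i j : exists c, A c /\ forall c', A c' -> le c c' ->
      forall x, sval c' i j x = sval c i j x.
    pose P (c : T) y := exists x, cdiff L j i (sval c i j x) = y.
    have Pcl c : lin_closed (P c).
      split=> [|_ _ [x <-] [y <-]|a _ [x <-]].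
      - by exists 0; rewrite !linear0.
      - by exists (x + y); rewrite !linearD.
      - by exists (a *: x); rewrite !linearZ.
    have leP a b : le a b -> forall x, P a x -> P b x.
      move=> ab _ [x <-]; exists (cdiff L j i (sval a i j x)).
      by rewrite (ab i j x).2.
    have [||c [Ac cmax]] := @noetherian_chain R (L i) T A P R_noeth (Lfg i) Pcl.
    - by exists c0.
    - move=> a b Aa Ab; have [/leP|/leP] := Atot a b Aa Ab; by [left|right].
    exists c; split=> // c' Ac' cc' x.
    have [|y yE] := cmax c' Ac' (cdiff L j i (sval c' i j x)); first by exists x.
    rewrite -(sds (svalP c')) -yE (cc' i j y).2.
    by rewrite -(cc' i j x).1 -yE (sds (svalP c)).
  have /choice[c cE] : forall ij : int * int, exists c, A c /\
      forall c', A c' -> le c c' ->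
      forall x, sval c' ij.1 ij.2 x = sval c ij.1 ij.2 x.
    by case=> i j; apply: cP.
  pose S : hfamily L L := fun i j => sval (c (i, j)) i j.
  have SE i j a : A a -> le (c (i, j)) a -> forall x, S i j x = sval a i j x.
    by move=> Aa ca x; rewrite ((cE (i, j)).2 a).
  have Sp : splitting S.
    split=> [i j x|i j k x]; first by rewrite /S (sds (svalP _)).
    have [Aa _] := cE (i, j); have [Ab _] := cE (j, k).
    have [ab|ba] := Atot _ _ Aa Ab.
      by rewrite (SE i j _ Ab ab) /S (sss (svalP _)).
    by rewrite (SE j k _ Aa ba) /S (sss (svalP _)).
  exists (exist _ S Sp) => a Aa; apply/asboolP => i j x /=.
  have [Ac _] := cE (i, j); have [ca|ac] := Atot _ _ Ac Aa.
    by rewrite !(SE i j a Aa ca) (sds (svalP a)).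
  exact: ac.
have [||s smax] := @ZL_preorder T s0 (fun a b => `[< le a b >]) _ _ chain.
- by move=> a; apply/asboolP/le_refl.
- by move=> a b c /asboolP ab /asboolP bc; apply/asboolP/(le_trans _ b).
exists (sval s) => [|T0 T0s i j x]; first exact: svalP.
have [s's ss' s's0] := splitting_extend (svalP s) T0s.
set s' := (X in splitting X) in s's ss' s's0.
have les : le s (exist _ s' s's) by move=> a b y; split; [exact: ss'|exact: s's0].
have /asboolP/(_ i j (val x))[E _] := smax _ (asboolT les).
have {}E : sval s i j (val x) =
    sval s i j (val x) + val (T0 i j (ker_proj (svalP s) i (val x))).
  exact: etrans (esym (s's0 i j _)) E.
move: E; rewrite ker_projK -[LHS]addr0 => /addrI/esym E.
exact: val_inj.
Qed.

End Minimality.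

(** * Purity of subcomplexes of bounded below complexes *)

(** The components of degree at most n form a subcomplex, as the differential
    lowers degrees. *)
Section Truncation.
Variables (R : pzRingType) (C : complex R) (n : int).

Lemma trunc_closed i : lin_closed (fun x : C i => i <= n \/ x = 0).
Proof.
split=> [|x y [?|->] [?|->]|a x [?|->]]; rewrite ?addr0 ?scaler0; by [left|right].
Qed.
Lemma trunc_sub i j x :
  x \in sub_of (@trunc_closed i) -> cdiff C i j x \in sub_of (@trunc_closed j).
Proof.
move=> /sub_ofP xt; apply/sub_ofP; case: xt => [ni|->].
  have [ij|ij] := eqVneq i (j + 1); last by right; apply: cdiff_shape.
  by left; lia.
by right; apply: linear0.
Qed.
Definition trunc : subcomplex C := Subcomplex trunc_sub.

Lemma truncT i x : i <= n -> x \in trunc i.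
Proof. by move=> ni; apply/sub_ofP; left. Qed.
Lemma trunc_zero i : n < i -> zero_module (sub_complex trunc i).
Proof.
move=> ni x; apply: val_inj; have /sub_ofP[|//] := valP x.
by rewrite leNgt ni.
Qed.
End Truncation.

Section PureMinimal.
Variables (R : pzRingType) (L : complex R) (n0 : int).
Hypotheses (R_noeth : left_noetherian R) (Lfg : degreewise_fin_gen L).
Hypothesis Lproj : forall i, projective (L i).
Hypothesis L0 : forall i, i < n0 -> zero_module (L i).

(** Purity is tested on the truncation A of L/S to degrees at most i, which is
    bounded and degreewise finitely presented: a lift of the inclusion
    A -> L/S to L is in degree i a section of L_i -> L_i/S_i. *)
Lemma pure_retraction (S : subcomplex L) i : pure_subcomplex S ->
  exists r : {linear L i -> L i},
    (forall x, r x \in S i) /\ (forall x, x \in S i -> r x = x).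
Proof.
move=> Spure; pose Q := quot_complex S; pose A := sub_complex (trunc Q i).
have Qfg k : fin_gen (Q k).
  by apply: (@fin_gen_surj _ _ _ (qproj (S k))) => // q; exists (qrepr q); apply: qreprK.
have Q0 k : k < n0 -> zero_module (Q k).
  move=> kn q; rewrite -[q]qreprK; apply/qproj_eq0.
  by rewrite (L0 kn (qrepr q)) rpred0.
have Afp : bounded_fin_pres A.
  split=> [|k]; last exact/noetherian_fin_pres/noetherian_submod.
  exists n0, i => k [kn|ik]; last exact: trunc_zero.
  by move=> x; apply: val_inj; apply: Q0.
have [_ _ lift] := Spure A Afp.
have [k kE] := lift (sub_incl (trunc Q i)).
pose t : {linear Q i -> A i} :=
  corestr (f := idfun : {linear Q i -> Q i}) (fun x => truncT x (lexx i)).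
have tE (q : Q i) : qproj (S i) (k i (t q)) = q by apply: (kE i (t q)).
exists (idfun \- (k i \o (t \o qproj (S i)))); split=> x.
  by apply/qproj_eq; rewrite [RHS]tE.
move=> /qproj_eq0 x0.
change (x - k i (t (qproj (S i) x)) = x); rewrite x0.
have -> : k i (t 0) = 0 by rewrite !linear0.
exact: subr0.
Qed.

(** S vanishes below degree i by induction, so d maps S_{i+1} onto S_i. Lifting
    the projection r : L_i -> S_i along it gives h with d h = r, and s = h r
    satisfies d s = r and s d s = s; so s = 0, hence r = 0. *)
Lemma disk_free_pure_minimal : disk_free L -> pure_minimal L.
Proof.
move=> Lfree S Spure [/acyclicP Sac _].
suff H (k : nat) : forall i x, i < n0 + k%:Z -> x \in S i -> x = 0.
  by move=> i x; apply: (H (absz (i - n0 + 1))); lia.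
elim: k => [|k IHk] i x; first by rewrite addr0 => ni _; apply: L0 ni x.
move=> ik xS; pose j := i + 1.
have S0 y : y \in S i -> forall l, cdiff L i l y = 0.
  move=> yS l; have [il|il] := eqVneq i (l + 1); last exact: cdiff_shape.
  by apply: IHk; [lia|apply: sub_cdiff].
have [r [rS rid]] := pure_retraction i Spure.
have [y|h hE] := @projective_lift _ _ _ _ (sub_diff S j i) (corestr rS) (@Lproj i).
  have [|z zE] := Sac j i (Submod (rS y)) erefl; last by exists z.
  by move=> l; apply: val_inj; apply: (S0 _ (rS y)).
pose s : {linear L i -> L j} := (val : {linear submod (S j) -> L j}) \o (h \o r).
have ds y : cdiff L j i (s y) = r y.
  by have /(congr1 val) := hE (r y); rewrite /= (rid (r y)).
have s0 : forall y, s y = 0.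
  by apply: disk_free_single => // y; rewrite ds /s /= (rid (r y)).
by rewrite -(rid x xS) -ds s0 linear0.
Qed.

End PureMinimal.

(** * Semi-projective complexes and quasi-isomorphisms *)

Section HomComplex.
Variable R : pzRingType.

Lemma signS (n : int) : (-1) ^+ absz (n + 1) = - (-1) ^+ `|n|%N :> R.
Proof.
case: n => n; first by rewrite -PoszD addn1 absz_nat exprS mulN1r.
have -> : Negz n + 1 = - n%:Z by lia.
by rewrite abszN absz_nat [absz (Negz n)]/= exprS mulN1r opprK.
Qed.

(** Multiplication by a general scalar is not linear over a noncommutative ring,
    but signs are central. *)
Lemma signed_linear (V W : lmodType R) (k : nat) (f : {linear V -> W}) :
  linear (fun x => (-1) ^+ k *: f x).
Proof.
by move=> a x y; rewrite linearP scalerDr !scalerA (commr_sign a k).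
Qed.
Definition signed (V W : lmodType R) k (f : {linear V -> W}) : {linear V -> W} :=
  linear_of (signed_linear k f).

Lemma hom_diffE (P X : complex R) n (f : hom_elt P X n) i j k l x :
  k = i + n -> l = i - 1 ->
  hom_diff f j x =
  cdiff X k j (f i k x) - (-1) ^+ `|n|%N *: f l j (cdiff P i l x).
Proof. by move=> -> ->. Qed.

(** A cycle f of the Hom complex is a boundary: the maps g_i with
    d g_i = f_i + (-1)^(n+1) g_{i-1} d are found by induction on i. The right-hand
    side has values in the cycles of X, which are boundaries, and P_i is
    projective. *)
Lemma bounded_semi_projective (P : complex R) (n0 : int) :
  (forall i, projective (P i)) -> (forall i, i < n0 -> zero_module (P i)) ->
  semi_projective P.
Proof.
move=> Pproj P0; split=> // X /acyclicP Xac n f fcyc.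
pose T i := forall j, {linear P i -> X j}.
(* The condition on the map t out of P_i that makes the next step possible. *)
pose G i (t : T i) := forall j k x, k = i + (n + 1) -> j = i + n ->
  is_cycle P i x -> cdiff X k j (t k x) = f i j x.
pose Rel (i : int) (t : T (i - 1)) (t' : T i) := forall j k x,
  k = i + (n + 1) -> j = i + n ->
  cdiff X k j (t' k x) =
  f i j x + (-1) ^+ absz (n + 1) *: t j (cdiff P i (i - 1) x).
have RelG i t t' : Rel i t t' -> G i t'.
  by move=> tt' j k x ki ji xc; rewrite (tt' j) // xc linear0 scaler0 addr0.
have [i ni|i ni|i t ni Gt|t [_ tR]] :=
    @int_dep_choice T G Rel n0 (fun i j => \0 : {linear _ -> _}).
- by move=> j k x _ _ _; rewrite (P0 i ni x) !linear0.
- by move=> j k x _ _; rewrite (P0 i ni x) !linear0 scaler0 addr0.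
- pose r : {linear P i -> X (i + n)} :=
    f i (i + n) \+ signed (absz (n + 1)) (t (i + n) \o cdiff P i (i - 1)).
  have rE x : r x =
      f i (i + n) x + (-1) ^+ absz (n + 1) *: t (i + n) (cdiff P i (i - 1) x).
    by [].
  have [//|x|h hE] := @projective_lift _ _ _ _ (cdiff X (i + (n + 1)) (i + n)) r.
    apply: Xac => [|j]; first by rewrite addrA.
    have [ij|ij] := eqVneq (i + n) (j + 1); last exact: cdiff_shape.
    have f0 := fcyc i j x; rewrite (@hom_diffE _ _ _ f i j (i + n) (i - 1)) // in f0.
    rewrite rE linearD linearZ_LR (Gt j (i + n)); [|lia|lia|].
      by rewrite signS scaleNr.
    by move=> k; apply: cdiff2.
  exists (fun j => ccast X (i + (n + 1)) j \o h).
  have RR : Rel i t (fun j => ccast X (i + (n + 1)) j \o h).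
    by move=> j k x -> ->; rewrite -rE -hE -[h x in RHS]ccast_id.
  by split; [exact: RelG RR|].
have gshape i j : j != i + (n + 1) -> forall x,
    (ccast X (i + (n + 1)) j \o t i (i + (n + 1))) x = 0.
  by move=> ij x; apply: ccast_neq; rewrite eq_sym.
pose g := HomElt gshape.
have gE i j x : g i j x = ccast X (i + (n + 1)) j (t i (i + (n + 1)) x) by [].
exists g => i j x; rewrite (@hom_diffE _ _ _ _ i j _ _ x erefl erefl) !gE.
have [ij|ij] := eqVneq j (i + n); last first.
  rewrite hfun_shape // cdiff_shape; last by apply/eqP; move/eqP: ij; lia.
  by rewrite ccast_neq ?scaler0 ?subr0 //; apply/eqP; move/eqP: ij; lia.

rewrite ccast_id (tR i j) //.
have -> : i - 1 + (n + 1) = j by lia.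
by rewrite ccast_id addrK.
Qed.

End HomComplex.

Section Cone.
Variables (R : pzRingType) (X Y : complex R) (s : chain_map X Y).

Definition cone_obj (i : int) : lmodType R := (Y i * X (i - 1))%type.
Definition cone_fun i j (u : cone_obj i) : cone_obj j :=
  (cdiff Y i j u.1 + s j (ccast X (i - 1) j u.2), - cdiff X (i - 1) (j - 1) u.2).
Lemma cone_linear i j : linear (@cone_fun i j).
Proof.
move=> a u v; congr pair; rewrite /= !linearP.
  by rewrite scalerDr addrACA.
by [].
Qed.
Definition cone_diff i j : {linear cone_obj i -> cone_obj j} :=
  linear_of (@cone_linear i j).
Lemma cone_diffE i j u : cone_diff i j u =
  (cdiff Y i j u.1 + s j (ccast X (i - 1) j u.2), - cdiff X (i - 1) (j - 1) u.2).
Proof. by []. Qed.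

Lemma cone_shape i j : i != j + 1 -> forall u, cone_diff i j u = 0.
Proof.
move=> /eqP ij u; rewrite cone_diffE !cdiff_shape ?ccast_neq //.
- by rewrite linear0 addr0 oppr0.
- by apply/eqP; lia.
- by apply/eqP; lia.
- by apply/eqP; lia.
Qed.

Lemma ccast_cdiff (C : complex R) i j k l x : j = k + 1 -> i = l + 1 ->
  cdiff C j k (ccast C i j x) = ccast C l k (cdiff C i l x).
Proof.
move=> jk il; case: (eqVneq i j) x => [ij|ij] x; last first.
  by rewrite ccast_neq // linear0 ccast_neq //; apply/eqP; move/eqP: ij; lia.
have kl : k = l by lia.
by subst k j i; rewrite !ccast_id.
Qed.

Lemma cone_diff2 i j k u : cone_diff j k (cone_diff i j u) = 0.
Proof.
have [ij|ij] := eqVneq i (j + 1); last by rewrite (cone_shape ij) linear0.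
have [jk|jk] := eqVneq j (k + 1); last exact: cone_shape.
rewrite !cone_diffE /= linearD cdiff2 add0r cmapC.
rewrite (@ccast_cdiff X (i - 1) j k (j - 1)) //; last by lia.
by rewrite !linearN cdiff2 /= subrr !oppr0.
Qed.

Definition cone : complex R := Complex cone_shape cone_diff2.

Lemma cone_acyclic : quasi_iso s -> acyclic cone.
Proof.
move=> /quasi_isoP[sinj ssurj]; apply/acyclicP => i j [y x] ij uc.
have jE : j = i - 1 by lia.
subst j => {ij}.
have /= [ys xc] : cdiff Y (i - 1) (i - 1 - 1) y + s (i - 1 - 1) x = 0 /\
    is_cycle X (i - 1 - 1) x.
  split=> [|j].
    by have /(congr1 fst) := uc (i - 1 - 1); rewrite [LHS]/= ccast_id.
  have [e|ne] := eqVneq (i - 1 - 1) (j + 1); last exact: cdiff_shape.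
  have /(congr1 snd)/= /eqP := uc (j + 1); rewrite oppr_eq0 addrK => /eqP.
  by [].
have [|x' x'E] := sinj (i - 1) (i - 1 - 1) x (esym (subrK 1 _)) xc.
  by exists (- y); rewrite linearN; apply/eqP; rewrite eqr_oppLR -addr_eq0 ys.
have [||c cc [y2 y2E]] := ssurj i (i - 1) (y + s (i - 1) x').
- by rewrite subrK.
- move=> j; have [e|ne] := eqVneq (i - 1) (j + 1); last exact: cdiff_shape.
  have -> : j = i - 1 - 1 by lia.
  by rewrite linearD cmapC x'E.
exists ((- y2, c - x') : Y i * X (i - 1)); rewrite [LHS]/= /cone_fun /=.
rewrite ccast_id linearN y2E (linearB (s _)) (linearB (cdiff X _ _)).
rewrite cc x'E sub0r opprK opprB.
by rewrite addrA subrK addrK.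
Qed.

End Cone.

Section Lifting.
Variable R : pzRingType.
Implicit Types Q X Y Z : complex R.

Definition comp_map X Y Z (g : chain_map Y Z) (f : chain_map X Y) : chain_map X Z.
Proof.
by apply: (@ChainMap R X Z (fun i => g i \o f i)) => i j x; rewrite /= !cmapC.
Defined.

Definition homotopic X Y (f g : chain_map X Y) : Prop :=
  exists h : hfamily X Y, homotopy h (fun i x => f i x - g i x).

Lemma homotopyI X Y (h : hfamily X Y) (u : forall i, X i -> Y i) :
  (forall i x, u i x =
     cdiff Y (i + 1) i (h i (i + 1) x) + h (i - 1) i (cdiff X i (i - 1) x)) ->
  homotopy h u.
Proof.
by move=> hu i j k x -> ik; have -> : k = i - 1 by rewrite ik addrK.
Qed.

Lemma homotopic_eq X Y (f g : chain_map X Y) :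
  (forall i, f i =1 g i) -> homotopic f g.
Proof.
move=> fg; exists (fun i j => \0) => i j k x _ _.
by rewrite fg subrr linear0 addr0.
Qed.
Lemma homotopic_sym X Y (f g : chain_map X Y) : homotopic f g -> homotopic g f.
Proof.
move=> [h hE]; exists (fun i j => \- h i j) => i j k x ji ik.
by rewrite -opprB (hE i j k) // opprD /= linearN.
Qed.
Lemma homotopic_trans X Y (f g e : chain_map X Y) :
  homotopic f g -> homotopic g e -> homotopic f e.
Proof.
move=> [h hE] [h' hE']; exists (fun i j => h i j \+ h' i j) => i j k x ji ik.
rewrite -[f i x](subrK (g i x)) -addrA (hE i j k) // (hE' i j k) //= linearD.
exact: addrACA.
Qed.
Lemma homotopic_compl X Y Z (e : chain_map Y Z) (f g : chain_map X Y) :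
  homotopic f g -> homotopic (comp_map e f) (comp_map e g).
Proof.
move=> [h hE]; exists (fun i j => e j \o h i j) => i j k x ji ik.
by rewrite /= -linearB (hE i j k) // linearD cmapC.
Qed.
Lemma homotopic_compr X Y Z (e : chain_map X Y) (f g : chain_map Y Z) :
  homotopic f g -> homotopic (comp_map f e) (comp_map g e).
Proof.
move=> [h hE]; exists (fun i j => h i j \o e i) => i j k x ji ik.
by rewrite /= (hE i j k) // cmapC.
Qed.

Lemma cdiff_ccast (C : complex R) i j k x : i = k + 1 ->
  cdiff C i j x = ccast C k j (cdiff C i k x).
Proof.
move=> ik; have [->|kj] := eqVneq k j; first by rewrite ccast_id.
rewrite ccast_neq // cdiff_shape //; apply/eqP; move/eqP: kj; lia.
Qed.

Lemma pair_linear (U V W : lmodType R) (a : {linear U -> V}) (b : {linear U -> W}) :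
  linear (fun x => (a x, b x) : (V * W)%type).
Proof. by move=> c x y; congr pair; rewrite linearP. Qed.
Definition pair_map (U V W : lmodType R) (a : {linear U -> V}) (b : {linear U -> W}) :
  {linear U -> (V * W)%type} := linear_of (pair_linear a b).

Variables (Q X Y : complex R) (s : chain_map X Y).
Hypotheses (Qsp : semi_projective Q) (qs : quasi_iso s).
Let C := cone s.

(** The map x |-> (k x, 0) is a cycle of degree 0 in Hom(Q, cone s), hence the
    boundary of some element g. The X-component of g is a chain map Q -> X, and
    the Y-component is the homotopy. *)
Lemma lift_quasi_iso (k : chain_map Q Y) :
  exists g : chain_map Q X, homotopic (comp_map s g) k.
Proof.
pose f i j : {linear Q i -> C j} := pair_map (ccast Y i j \o k i) \0.
have fE i j x : f i j x = (ccast Y i j (k i x), 0) by [].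
have fshape i j : j != i + 0 -> forall x, f i j x = 0.
  by rewrite addr0 eq_sym => ij x; rewrite fE ccast_neq.
pose F : hom_elt Q C 0 := HomElt fshape.
have FE i j x : F i j x = (ccast Y i j (k i x), 0) by [].
have [|g gE] := Qsp.2 C (cone_acyclic qs) 0 F.
  move=> i j x; rewrite (@hom_diffE _ _ _ _ _ i j i (i - 1)) ?addr0 //.
  rewrite !FE cone_diffE /= expr0 scale1r ccast_id !linear0 addr0.
  rewrite (@cdiff_ccast Y i j (i - 1)) ?subrK // cmapC.
  by congr pair; rewrite subrr.
have {}gE i j l x : j = i + 1 -> i = l + 1 ->
    cone_diff s j i (g i j x) + g l i (cdiff Q i l x) = (k i x, 0).
  move=> ji il; rewrite -[k i x](@ccast_id R Y i _) -FE -gE (@hom_diffE _ _ _ _ _ i i j l) ?ji ?il ?addrK //.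
  by rewrite expr1 scaleN1r opprK.
have g1 i j l x : j = i + 1 -> i = l + 1 ->
    cdiff Y j i (g i j x).1 + s i (ccast X (j - 1) i (g i j x).2) +
    (g l i (cdiff Q i l x)).1 = k i x.
  by move=> ji il; have /(congr1 fst) := gE i j l x ji il.
have g2 i j l x : j = i + 1 -> i = l + 1 ->
    (g l i (cdiff Q i l x)).2 = cdiff X (j - 1) (i - 1) (g i j x).2.
  move=> ji il; have /(congr1 snd)/= /eqP := gE i j l x ji il.
  by rewrite addr_eq0 eqr_opp => /eqP.
pose e i : {linear Q i -> X i} :=
  ccast X (i + 1 - 1) i \o (snd \o g i (i + 1) : {linear _ -> _}).
have eE i x : e i x = ccast X (i + 1 - 1) i (g i (i + 1) x).2 by [].
have eC i j x : cdiff X i j (e i x) = e j (cdiff Q i j x).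
  have [ij|ij] := eqVneq i (j + 1); last by rewrite !(cdiff_shape ij) linear0.
  subst i; rewrite !eE (@ccast_cdiff R X _ (j + 1) j (j + 1 - 1)) ?addrK ?subrK //.
  by rewrite (@g2 _ (j + 1 + 1)).
exists (ChainMap eC); apply: homotopic_sym.
exists (fun i j => fst \o g i j : {linear _ -> _}).
apply: homotopyI => i x; change (k i x - s i (e i x) =
  cdiff Y (i + 1) i (g i (i + 1) x).1 + (g (i - 1) i (cdiff Q i (i - 1) x)).1).
rewrite eE -(@g1 i (i + 1) (i - 1)) ?subrK //.
by rewrite addrAC addrK.
Qed.

(** With u = k - k' and a homotopy h from s u to 0, the map x |-> (h x, - u x) is
    a cycle of degree 1 in Hom(Q, cone s), hence the boundary of some element g.
    The X-component of g is a homotopy from u to 0. *)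
Lemma cancel_quasi_iso (k k' : chain_map Q X) :
  homotopic (comp_map s k) (comp_map s k') -> homotopic k k'.
Proof.
move=> [h hE]; pose u i : {linear Q i -> X i} := k i \- k' i.
have uE i x : u i x = k i x - k' i x by [].
have uC i j x : cdiff X i j (u i x) = u j (cdiff Q i j x).
  by rewrite !uE linearB !cmapC.
have {}hE i j l x : j = i + 1 -> i = l + 1 ->
    s i (u i x) = cdiff Y j i (h i j x) + h l i (cdiff Q i l x).
  by move=> ji il; rewrite uE linearB -(hE i j l x ji il).
pose f i j : {linear Q i -> C j} :=
  pair_map (ccast Y (i + 1) j \o h i (i + 1)) (\- (ccast X i (j - 1) \o u i)).
have fE i j x : f i j x =
  (ccast Y (i + 1) j (h i (i + 1) x), - ccast X i (j - 1) (u i x)) by [].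
have fshape i j : j != i + 1 -> forall x, f i j x = 0.
  move=> ij x; rewrite fE !ccast_neq ?oppr0 //; last by rewrite eq_sym.
  by apply/eqP; move/eqP: ij; lia.
pose F : hom_elt Q C 1 := HomElt fshape.
have FE i j x : F i j x =
  (ccast Y (i + 1) j (h i (i + 1) x), - ccast X i (j - 1) (u i x)) by [].
have [|g gE] := Qsp.2 C (cone_acyclic qs) 1 F.
  move=> i j x; rewrite (@hom_diffE _ _ _ _ _ i j (i + 1) (i - 1)) //.
  rewrite expr1 scaleN1r opprK.
  have [ji|ji] := eqVneq j i; last first.
    rewrite (@hfun_shape _ _ _ _ F (i - 1) j) ?subrK // (@cdiff_shape _ C) ?addr0 //.
    by rewrite (inj_eq (addIr 1)) eq_sym.
  subst j; rewrite !FE cone_diffE /= !subrK ccast_id linearN linearN /=.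
  congr pair; last first.
    rewrite linearN opprK (@ccast_cdiff R X _ (i + 1 - 1) (i - 1) (i - 1)) ?addrK ?subrK //.
    by rewrite uC subrr.
  have -> : ccast X (i + 1 - 1) i (ccast X i (i + 1 - 1) (u i x)) = u i x.
    by rewrite addrK !ccast_id.
  rewrite (hE i (i + 1) (i - 1)) ?subrK //.
  by rewrite ccast_id opprD addrA subrr sub0r addNr.
pose h' i j : {linear Q i -> X j} :=
  ccast X (j + 1 - 1) j \o (snd \o g i (j + 1) : {linear _ -> _}).
have h'E i j x : h' i j x = ccast X (j + 1 - 1) j (g i (j + 1) x).2 by [].
exists h'; apply: homotopyI => i x; rewrite -uE !h'E.
have E : - cdiff X (i + 1 + 1 - 1) (i + 1 - 1) (g i (i + 1 + 1) x).2
    - (g (i - 1) (i + 1) (cdiff Q i (i - 1) x)).2 = - ccast X i (i + 1 - 1) (u i x).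
  have := gE i (i + 1) x.
  rewrite (@hom_diffE _ _ _ _ _ i _ (i + 1 + 1) (i - 1)) ?addrA //.
  by rewrite expr2 mulrNN mulr1 scale1r => /(congr1 snd).
move/(congr1 (ccast X (i + 1 - 1) i)): E; rewrite -opprD !linearN => /oppr_inj.
rewrite linearD -(@ccast_cdiff R X _ (i + 1) i) ?addrK ?subrK // => ->.
by rewrite addrK !ccast_id.
Qed.

End Lifting.

(** * Morphisms of the derived category *)

Section Derived.
Variable R : pzRingType.
Implicit Types L M P Q X Y Z : complex R.

(** The action of a formal morphism u : X -> Y on homotopy classes of maps out of
    Q, as a relation: a formal inverse of s relates x to every y such that s y is
    homotopic to x. When Q is semi-projective the relation is total and depends
    only on the class of u in the derived category. *)
Fixpoint der_rel Q X Y (u : der_hom X Y) {struct u} :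
    chain_map Q X -> chain_map Q Y -> Prop :=
  match u in der_hom X Y return chain_map Q X -> chain_map Q Y -> Prop with
  | der_map _ _ f => fun x y => homotopic (comp_map f x) y
  | der_inv _ _ s _ => fun x y => homotopic (comp_map s y) x
  | der_comp _ _ _ g f => fun x y => exists2 z, der_rel f x z & der_rel g z y
  end.

Lemma der_rel_homotopic Q X Y (u : der_hom X Y) (x x' : chain_map Q X) y y' :
  homotopic x x' -> homotopic y y' -> der_rel u x y -> der_rel u x' y'.
Proof.
elim: u x x' y y' => {X Y} [X Y f|X Y s qs|X Y Z g IHg f IHf] x x' y y' xx' yy' /=.
- move=> xy; apply: homotopic_trans yy'; apply: homotopic_trans xy.
  exact/homotopic_compl/homotopic_sym.
- move=> xy; apply: homotopic_trans xx'; apply: homotopic_trans xy.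
  exact/homotopic_compl/homotopic_sym.
- move=> [z xz zy]; exists z; first exact: IHf xx' (homotopic_eq _) xz.
  exact: IHg (homotopic_eq _) yy' zy.
Qed.

Lemma der_rel_natural P Q X Y (u : der_hom X Y) (a : chain_map P Q) x y :
  der_rel u x y -> der_rel u (comp_map x a) (comp_map y a).
Proof.
elim: u x y => {X Y} [X Y f|X Y s qs|X Y Z g IHg f IHf] x y /=.
- by move=> /(homotopic_compr a).
- by move=> /(homotopic_compr a).
- by move=> [z /IHf xz /IHg zy]; exists (comp_map z a).
Qed.

Section Source.
Variables (Q : complex R) (Qsp : semi_projective Q).

Lemma der_rel_total X Y (u : der_hom X Y) (x : chain_map Q X) :
  exists y, der_rel u x y.
Proof.
elim: u x => {X Y} [X Y f|X Y s qs|X Y Z g IHg f IHf] x /=.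
- by exists (comp_map f x); apply: homotopic_eq.
- exact: lift_quasi_iso.
- by have [z xz] := IHf x; have [y zy] := IHg z; exists y, z.
Qed.

Lemma der_rel_eq X Y (u v : der_hom X Y) : der_eq u v ->
  forall (x : chain_map Q X) y, der_rel u x y <-> der_rel v x y.
Proof.
elim=> {X Y u v}.
- by [].
- by move=> X Y f g _ IH x y; split=> /IH.
- by move=> X Y f g h _ IH1 _ IH2 x y; rewrite IH1.
- move=> X Y Z g g' f f' _ IHg _ IHf x y; split=> -[z xz zy]; exists z.
  + exact/IHf. + exact/IHg. + exact/IHf. + exact/IHg.
- move=> X Y Z W h g f x y; split.
    by move=> [z [w xw wz] zy]; exists w => //; exists z.
  by move=> [w xw [z wz zy]]; exists z => //; exists w.
- move=> X Y f x y; split=> [[z xz zy]|xy].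
    apply: der_rel_homotopic xz; first exact: homotopic_eq.
    by apply: homotopic_trans zy; apply: homotopic_eq.
  by exists y => //; apply: homotopic_eq.
- move=> X Y f x y; split=> [[z xz zy]|xy].
    apply: der_rel_homotopic zy; last exact: homotopic_eq.
    apply/homotopic_sym; apply: homotopic_trans xz; exact: homotopic_eq.
  by exists x => //; apply: homotopic_eq.
- move=> X Y Z g f h hgf x y; split=> [xy|[z xz zy]] /=.
    exists (comp_map f x); first exact: homotopic_eq.
    apply: homotopic_trans xy; apply: homotopic_eq => i a /=.
    by rewrite hgf.
  apply: homotopic_trans zy; apply: homotopic_trans (homotopic_compl g xz).
  by apply: homotopic_eq => i a /=; rewrite hgf.
- move=> X Y s qs x y; split=> [[z xz zy]|xy].
    have xy : homotopic x y.
      apply: (cancel_quasi_iso Qsp qs); apply: homotopic_trans xz _.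
      exact: homotopic_sym.
    by apply: homotopic_trans xy; apply: homotopic_eq.
  exists (comp_map s x); first exact: homotopic_eq.
  apply/homotopic_compl/homotopic_sym.
  by apply: homotopic_trans xy; apply: homotopic_eq.
- move=> X Y s qs x y; split=> [[z xz zy]|xy].
    have xy : homotopic x y by apply: homotopic_trans (homotopic_sym xz) zy.
    by apply: homotopic_trans xy; apply: homotopic_eq.
  have [z zx] := lift_quasi_iso Qsp qs x; exists z => //.
  apply: homotopic_trans zx _.
  by apply: homotopic_trans xy; apply: homotopic_eq.
Qed.

End Source.

(** Let u : M -> P and v : P -> M be inverse to each other in the derived
    category. Then f is the image of p under u, and g is a lift along p of the
    image z of the identity of P under v. By naturality v sends f to z f, so that
    p g f and z f are both homotopic to v u p = p; now cancel p. *)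
Lemma derived_iso_factor L M P (p : chain_map L M) :
  semi_projective_resolution p -> semi_projective P -> derived_iso M P ->
  exists (f : chain_map L P) (g : chain_map P L),
    homotopic (id_chain_map L) (comp_map g f).
Proof.
move=> [Lsp qp] Psp [u [v [vu _]]].
have [f pf] := der_rel_total Lsp u p.
have [z idz] := der_rel_total Psp v (id_chain_map P).
have [g gz] := lift_quasi_iso Psp qp z.
exists f, g; apply: (cancel_quasi_iso Lsp qp).
have fz : der_rel v f (comp_map z f).
  apply: der_rel_homotopic (der_rel_natural f idz); exact: homotopic_eq.
have pz : der_rel (der_id M) p (comp_map z f).
  by apply/(der_rel_eq Lsp vu); exists f.
apply: homotopic_trans (_ : homotopic _ p) _; first exact: homotopic_eq.
have {}pz : homotopic p (comp_map z f).
  by apply: homotopic_trans pz; apply: homotopic_eq.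
apply: homotopic_trans pz _; apply: homotopic_sym.
apply: homotopic_trans (homotopic_compr f gz).
exact: homotopic_eq.
Qed.

Lemma resolution_derived_iso L M (p : chain_map L M) :
  quasi_iso p -> derived_iso M L.
Proof.
move=> qp; exists (der_inv qp), (der_map p).
by split; [apply: der_invr|apply: der_invl].
Qed.

End Derived.

(** * Resolutions by finitely generated projectives *)

Section Resolution.
Variable R : pzRingType.

Section ComplexOf.
Variables (V : int -> lmodType R) (d : forall i, {linear V i -> V (i - 1)}).
Hypothesis dd : forall i x, d (i - 1) (d i x) = 0.

Definition seq_diff i j : {linear V i -> V j} := ccast V (i - 1) j \o d i.
Lemma seq_diffE i j x : seq_diff i j x = ccast V (i - 1) j (d i x).
Proof. by []. Qed.
Lemma seq_shape i j : i != j + 1 -> forall x, seq_diff i j x = 0.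
Proof. by move=> ij x; rewrite seq_diffE ccast_neq // subr_eq. Qed.
Lemma seq_diff2 i j k x : seq_diff j k (seq_diff i j x) = 0.
Proof.
have [->|ij] := eqVneq j (i - 1); first by rewrite !seq_diffE ccast_id dd linear0.
by rewrite [seq_diff i j x]seq_diffE ccast_neq ?linear0 // eq_sym.
Qed.
Definition complex_of : complex R := Complex seq_shape seq_diff2.
Lemma complex_of_diff i x : cdiff complex_of i (i - 1) x = d i x.
Proof. by rewrite [LHS]seq_diffE ccast_id. Qed.
End ComplexOf.

Lemma lin_closed_ker (V W : lmodType R) (f : {linear V -> W}) :
  lin_closed (fun v => f v = 0).
Proof.
split=> [|u v fu fv|a u fu]; first exact: linear0.
  by rewrite linearD fu fv addr0.
by rewrite linearZ_LR fu scaler0.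
Qed.

Hypothesis R_noeth : left_noetherian R.
Variables (M : complex R) (n0 : int).
Hypothesis HM_fg : forall i, fin_gen (homology M i).
Hypothesis HM0 : forall i, i < n0 -> zero_module (homology M i).

Lemma homology_gens i : exists n (w : 'I_n -> M i),
  (forall b, is_cycle M i (w b)) /\
  forall x, is_cycle M i x -> exists (c : 'rV[R]_n) (y : M (i + 1)),
    cdiff M (i + 1) i y = lincomb w c - x.
Proof.
have [n [g gE]] := HM_fg i; exists n, (fun b => val (qrepr (g b))); split.
  by move=> b; apply/cycleP/valP.
move=> x /cycleP xc; have [a aE] := gE (qproj (boundaries M i) (Submod xc)).
pose z : submod (cycles M i) := \sum_(b < n) a b *: qrepr (g b).
have /qproj_eq/boundariesP[y yE] :
    qproj (boundaries M i) z = qproj (boundaries M i) (Submod xc).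
  rewrite aE linear_sum; apply: eq_bigr => b _.
  by rewrite linearZ; congr (_ *: _); exact: qreprK.
exists (\row_b a b), y; rewrite lincombE yE.
have <- : val z = \sum_(b < n) a b *: val (qrepr (g b)).
  by rewrite linear_sum; apply: eq_bigr => b _; rewrite linearZ.
by [].
Qed.

(** One degree of the resolution. The predicate stands for the cycles, that is,
    for the kernel of the differential into the previous degree; recording it
    separately lets a stage refer to its own degree only. *)
Record stage (i : int) := Stage {
  stage_obj : lmodType R;
  stage_cyc : stage_obj -> Prop;
  stage_map : {linear stage_obj -> M i} }.

(** The last condition says that the cycles reach all homology classes of M in
    degree i. *)
Definition good_stage i (t : stage i) : Prop :=
  [/\ projective (stage_obj t) /\ fin_gen (stage_obj t),
      i < n0 -> zero_module (stage_obj t),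
      lin_closed (@stage_cyc i t),
      (forall z, @stage_cyc i t z -> is_cycle M i (stage_map t z)) &
      (forall m, is_cycle M i m -> exists2 z, @stage_cyc i t z &
         exists y : M (i + 1), cdiff M (i + 1) i y = stage_map t z - m)].

(** The image of D consists of the cycles that become boundaries in M, which makes
    the map on homology injective in degree i - 1. *)
Definition next_stage i (t : stage (i - 1)) (t' : stage i) : Prop :=
  exists D : {linear stage_obj t' -> stage_obj t},
    [/\ forall x, stage_cyc x <-> D x = 0,
        forall z, (exists x, D x = z) <->
          stage_cyc z /\ exists y : M i, cdiff M i (i - 1) y = stage_map t z &
        forall x, cdiff M i (i - 1) (stage_map t' x) = stage_map t (D x)].

(** The new module is free on two finite sets of generators: the first m are sent
    by D to generators z_a of the module of cycles that become boundaries in M,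
    the last n are cycles mapped to representatives w_b of generators of the
    homology of M in degree i. *)
Lemma next_stage_exists i (t : stage (i - 1)) : n0 <= i -> good_stage t ->
  exists t', good_stage t' /\ next_stage t t'.
Proof.
move=> ni [[Vproj Vfg] _ Zcl Zcyc Zsurj].
pose K z := stage_cyc z /\ exists y : M i, cdiff M i (i - 1) y = stage_map t z.
have Kcl : lin_closed K.
  have [Z0 ZD ZZ] := Zcl; split.
  - by split=> //; exists 0; rewrite !linear0.
  - move=> x y [Zx [u uE]] [Zy [v vE]]; split; first exact: ZD.
    by exists (u + v); rewrite !linearD uE vE.
  - move=> a x [Zx [u uE]]; split; first exact: ZZ.
    by exists (a *: u); rewrite !linearZ_LR uE.
have [m [z [zK zE]]] := noetherian_fin_gen R_noeth Vfg Kcl.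
have /choice[y yE] : forall a, exists y : M i, cdiff M i (i - 1) y = stage_map t (z a).
  by move=> a; case: (zK a).
have [n [w [wc wE]]] := homology_gens i.
pose D : {linear 'rV[R]_(m + n) -> stage_obj t} :=
  lincomb z \o (lsubmx : {linear 'rV[R]_(m + n) -> 'rV[R]_m}).
pose p : {linear 'rV[R]_(m + n) -> M i} :=
  (lincomb y \o (lsubmx : {linear 'rV[R]_(m + n) -> 'rV[R]_m})) \+
  (lincomb w \o (rsubmx : {linear 'rV[R]_(m + n) -> 'rV[R]_n})).
have DE v : D v = lincomb z (lsubmx v) by [].
have pE v : p v = lincomb y (lsubmx v) + lincomb w (rsubmx v) by [].
have pd v : cdiff M i (i - 1) (p v) = stage_map t (D v).
  rewrite pE DE linearD !lincomb_comp.
  have -> : lincomb (cdiff M i (i - 1) \o w) (rsubmx v) = 0.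
    by apply: big1 => b _ /=; rewrite wc scaler0.
  by rewrite addr0; apply: eq_bigr => a _ /=; rewrite yE.
exists (@Stage i 'rV[R]_(m + n) (fun v => D v = 0) p); split.
  split=> [||||x xc]; first by split; [exact: projective_free|exact: fin_gen_free].
  - by rewrite ltNge ni.
  - exact: (lin_closed_ker D).
  - move=> v Dv j; have [ij|ij] := eqVneq i (j + 1); last exact: cdiff_shape.
    have -> : j = i - 1 by rewrite ij addrK.
    by rewrite pd Dv linear0.
  have [c [u uE]] := wE x xc; exists (row_mx 0 c).
    by apply: etrans (DE _) _; rewrite row_mxKl linear0.
  exists u; change (cdiff M (i + 1) i u = p (row_mx 0 c) - x).
  by rewrite pE row_mxKl row_mxKr linear0 add0r.
exists D; split=> [//|v|]; last exact: pd.
split=> [[x <-]|/zE[a ->]].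
  by rewrite DE; apply: (lin_closed_sum _ Kcl).
by exists (row_mx (\row_k a k) 0); rewrite DE row_mxKl lincombE.
Qed.

Lemma fin_gen_projective_resolution : exists (L : complex R) (p : chain_map L M),
  [/\ quasi_iso p, forall i, projective (L i), degreewise_fin_gen L &
      forall i, i < n0 -> zero_module (L i)].
Proof.
pose t0 i := @Stage i 'rV[R]_0 (fun=> True) \0.
have rV0 (x : 'rV[R]_0) : x = 0 by apply/rowP; case.
have [i ni|i ni|i t ni|t [tG]] := @int_dep_choice stage good_stage next_stage n0 t0.
- split=> //= [|z _ j|m mc]; first by split; [exact: projective_free|exact: fin_gen_free].
    by rewrite linear0.
  have [y yE] := (homology0P M i).1 (HM0 ni) m mc.
  by exists 0 => //; exists (- y); rewrite linearN yE sub0r.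
- exists \0; split=> //= [z|x]; last by rewrite linear0.
  split=> _; first by split=> //; exists 0; rewrite linear0.
  by exists 0; rewrite (rV0 z).
- exact: next_stage_exists.
move=> tR; pose D i := sval (cid (tR i)).
have D1 i x : stage_cyc (s := t i) x <-> D i x = 0.
  by rewrite /D; case: cid => d [].
have D2 i z : (exists x, D i x = z) <-> stage_cyc (s := t (i - 1)) z /\
    exists y : M i, cdiff M i (i - 1) y = stage_map (t (i - 1)) z.
  by rewrite /D; case: cid => d [].
have D3 i x : cdiff M i (i - 1) (stage_map (t i) x) = stage_map (t (i - 1)) (D i x).
  by rewrite /D; case: cid => d [].
have DD i x : D (i - 1) (D i x) = 0.
  by apply/D1; have [] := (D2 i (D i x)).1 (ex_intro _ x erefl).
pose L := complex_of DD.
have pC i j x : cdiff M i j (stage_map (t i) x) = stage_map (t j) (cdiff L i j x).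
  have [ij|ij] := eqVneq i (j + 1); last by rewrite !cdiff_shape // linear0.
  have -> : j = i - 1 by rewrite ij addrK.
  by rewrite complex_of_diff D3.
have cycE i (x : L i) : is_cycle L i x <-> stage_cyc (s := t i) x.
  split=> [xc|/D1 Dx j]; first by apply/D1; rewrite -(complex_of_diff (dd := DD)) xc.
  have [ij|ij] := eqVneq i (j + 1); last exact: cdiff_shape.
  have -> : j = i - 1 by rewrite ij addrK.
  by rewrite complex_of_diff.
exists L, (@ChainMap R L M (fun i => stage_map (t i)) pC); split.
- apply/quasi_isoP; split=> i j x ij; have jE : j = i - 1 by rewrite ij addrK.
    subst j => /cycE xc [y yE].
    have [|u uE] := (D2 i x).2; first by split=> //; exists y.
    by exists u; rewrite complex_of_diff.
  move=> xc; have [_ _ _ _ surj] := tG j.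
  have [z /cycE zc [y yE]] := surj x xc; exists z => //.
  by rewrite ij; exists y.
- by move=> i; have [[]] := tG i.
- by move=> i; have [[]] := tG i.
- by move=> i; have [_] := tG i.
Qed.
End Resolution.

(** * The projective dimension *)

Section ExtendedIntegers.
Implicit Types (S : set (\bar int)) (A : set int).

Lemma supremum_eq x0 S y : (exists x, S x) -> ubound S y ->
  (forall z, ubound S z -> (y <= z)%O) -> supremum x0 S = y.
Proof.
move=> [x Sx] yub ymin; rewrite /supremum; case: ifPn => [/eqP S0|_].
  by rewrite S0 in Sx.
case: xgetP => [z _ [zub zmin]|/(_ y)[]]; last by split.
by apply/le_anti/andP; split; [apply: zmin|apply: ymin].
Qed.

Lemma infimum_eq x0 S y : (exists x, S x) -> lbound S y ->
  (forall z, lbound S z -> (z <= y)%O) -> infimum x0 S = y.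
Proof.
move=> [x Sx] ylb ymax; rewrite /infimum; case: ifPn => [/eqP S0|_].
  by rewrite S0 in Sx.
case: xgetP => [z _ [zlb zmax]|/(_ y)[]]; last by split.
by apply/le_anti/andP; split; [apply: ymax|apply: zmax].
Qed.

(** The upper bounds of A are all integers when A is empty, none when A is
    unbounded, and those from max A on otherwise. *)
Lemma int_inf_ubound (A U : set int) :
  (forall n, U n <-> forall i, A i -> i <= n) -> int_inf U = int_sup A.
Proof.
move=> UE; have [A0|/set0P[a Aa]] := eqVneq A set0.
  have UT n : [set n%:E | n in U]%classic n%:E.
    by exists n => //; apply/UE => i; rewrite A0.
  rewrite A0 /int_sup image_set0 supremum0.
  apply: infimum_eq => [|x _|[r||] zlb //]; first by exists 0%:E; apply: UT.
  - exact: leNye.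
  - by have := zlb _ (UT (r - 1)); rewrite lee_fin; lia.
  - by have := zlb _ (UT 0).
have [[n /UE nub]|noub] := pselect (exists n, U n); last first.
  have -> : U = set0 by apply/seteqP; split=> // n nU; case: noub; exists n.
  rewrite /int_inf image_set0 /infimum eqxx; apply/esym/supremum_eq.
  - by exists a%:E, a.
  - by move=> x _; apply: leey.
  - move=> [r||] zub //.
      case: noub; exists r; apply/UE => i Ai.
      by have := zub i%:E (ex_intro2 _ _ i Ai erefl); rewrite lee_fin.
    by have := zub a%:E (ex_intro2 _ _ a Aa erefl).
have [m Am mub] : exists2 m, A m & forall i, A i -> i <= m.
  have [k] := ubnP (absz (n - a)); elim: k a Aa => // k IHk b Ab bk.
  have [[c [Ac bc]]|nc] := pselect (exists c, A c /\ b < c).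
    by apply: (IHk c Ac); have := nub c Ac; lia.
  by exists b => // i Ai; rewrite leNgt; apply/negP => bi; apply: nc; exists i.
have -> : int_sup A = m%:E.
  apply: supremum_eq; first by exists m%:E, m.
  - by move=> _ [i Ai <-]; rewrite lee_fin; apply: mub.
  - by move=> z; apply; exists m.
apply: infimum_eq; first by exists m%:E, m => //; apply/UE.
- by move=> _ [k /UE kub <-]; rewrite lee_fin; apply: kub.
- by move=> z; apply; exists m => //; apply/UE.
Qed.
End ExtendedIntegers.

Lemma proj_dim_disk_free (R : pzRingType) (L M : complex R) (p : chain_map L M) :
  semi_projective_resolution p -> disk_free L ->
  proj_dim M = int_sup [set i : int | ~ zero_module (L i)]%classic.
Proof.
move=> Lres Lfree; apply: int_inf_ubound => n; split=> [[P [Psp MP P0]] i Li|nub].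
  rewrite leNgt; apply/negP => ni; apply: Li.
  have [f [g [h hE]]] := derived_iso_factor Lres Psp MP.
  apply: (disk_free_bound Lfree hE _ ni) => {ni}i x ni.
  by rewrite /= (P0 i ni (f i x)) linear0.
exists L; split; [exact: Lres.1|exact: resolution_derived_iso Lres.2|].
by move=> i ni; apply: contrapT => /nub; rewrite leNgt ni.
Qed.

Theorem mainTheorem6 (R : pzRingType) (M : complex R)
    (R_noeth : left_noetherian R)
    (HM_fg : forall i : int, fin_gen (homology M i))
    (HM_bounded : exists n : int, forall i, i < n ->
       zero_module (homology M i)) :
  (exists (L : complex R) (p : chain_map L M),
     [/\ semi_projective_resolution p, pure_minimal L &
         degreewise_fin_gen L]) /\
  (forall (L : complex R) (p : chain_map L M),
     semi_projective_resolution p -> pure_minimal L ->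
     degreewise_fin_gen L ->
     proj_dim M = int_sup [set i : int | ~ zero_module (L i)]%classic).
Proof.
split=> [|L p Lres Lmin _]; last first.
  exact/(proj_dim_disk_free Lres)/pure_minimal_disk_free.
have [n HM0] := HM_bounded.
have [F [q [qq Fproj Ffg F0]]] := fin_gen_projective_resolution R_noeth HM_fg HM0.
have [s ss Kfree] := exists_disk_free_kernel R_noeth Ffg.
have [p pq] := ker_quasi_iso ss qq.
have Kproj i : projective (sub_complex (idem_ker s) i) by apply: ker_projective.
have Kfg i : fin_gen (sub_complex (idem_ker s) i) by apply: ker_fin_gen.
have K0 i : i < n -> zero_module (sub_complex (idem_ker s) i).
  by move=> ni x; apply: val_inj; apply: F0.
exists (sub_complex (idem_ker s)), p; split=> //.
  by split=> //; apply: bounded_semi_projective K0.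
exact: (disk_free_pure_minimal R_noeth Kfg Kproj K0).
Qed.
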